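(* Let $I$ be a non-empty set, let $E$ be a Banach sequence lattice on $I$, let $(A_i)_{i\in I}$ be a family of Banach algebras, and let $A:=\bigl(\bigoplus_{i\in I}A_i\bigr)_{E}$ be their $E$-sum. Then: (1) One always has $\sup_{i\in I}\mathrm{AM}(A_i)\le \mathrm{AM}(A)$. (2) Assume, in addition, that $C_E=\sup\{\|\chi_F\|_E: F\subseteq I \text{ finite}\}<\infty$. Then $A$ is amenable if and only if $\sup_{i\in I}\mathrm{AM}(A_i)<\infty$. In this case, $$\sup_{i\in I}\mathrm{AM}(A_i)\ \le\ \mathrm{AM}(A)\ \le\ C_E^2\,\sup_{i\in I}\mathrm{AM}(A_i).$$
   Context: All Banach spaces and algebras are complex. $c_{00}(I)$ denotes the finitely supported complex functions on $I$, and $\chi_F$ the characteristic function of $F\subseteq I$. Amenability constant. For a Banach algebra $A$, $A\widehat{\otimes}A$ is the projective tensor product, $\pi\colon A\widehat{\otimes}A\to A$ is the product map $\pi(a\otimes b)=ab$, and $A\widehat{\otimes}A$ is an $A$-bimodule via $a\cdot(x\otimes y)=(ax)\otimes y$, $(x\otimes y)\cdot a=x\otimes(ya)$; the actions extend canonically to $(A\widehat{\otimes}A)^{**}$. A virtual diagonal for $A$ is $M\in(A\widehat{\otimes}A)^{**}$ with $a\cdot M=M\cdot a$ and $a\cdot\pi^{**}(M)=a=\pi^{**}(M)\cdot a$ for all $a\in A$. $A$ is amenable if it has a virtual diagonal; then $\mathrm{AM}(A):=\inf\{\|M\|: M \text{ a virtual diagonal for } A\}$, and $\mathrm{AM}(A):=+\infty$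 if $A$ is not amenable. Banach sequence lattice. A Banach sequence lattice on $I$ is a Banach space $E$ of complex-valued functions on $I$ such that (a) $c_{00}(I)\subseteq E\subseteq\ell_\infty(I)$ and $c_{00}(I)$ is dense in $E$; (b) $E$ is solid: if $y\in E$, $x\in\ell_\infty(I)$ and $|x_i|\le|y_i|$ for all $i$, then $x\in E$ and $\|x\|_E\le\|y\|_E$; (c) $\|x\|_\infty\le\|x\|_E$ for all $x\in E$. $E$-sum. $\bigl(\bigoplus_{i\in I}A_i\bigr)_E$ is the Banach algebra of all families $a=(a_i)_{i\in I}$, $a_i\in A_i$, with $(\|a_i\|)_{i\in I}\in E$, with norm $\|a\|=\|(\|a_i\|)_{i\in I}\|_E$ and coordinatewise multiplication. *)

(* Defs.v *)
From HB Require Import structures.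
From mathcomp Require Import all_boot all_order all_algebra.
From mathcomp Require Import all_classical all_reals all_analysis.
From mathcomp Require Import complex ring.
Set Implicit Arguments.
Unset Strict Implicit.
Unset Printing Implicit Defensive.
Import Order.TTheory GRing.Theory Num.Theory.
Import numFieldNormedType.Exports.
Local Open Scope classical_set_scope.
Local Open Scope quotient_scope.
Local Open Scope ring_scope.
Local Open Scope complex_scope.

(** Norms of the library are valued in the scalar field, here [R[i]]; [nrm]
    is the same norm read in [R]. *)
Definition nrm {R : realType} {V : normedZmodType R[i]} (x : V) : R :=
  complex.Re `|x|.

Section Nrm.
Context {R : realType}.

Lemma nrmE (V : normedZmodType R[i]) (x : V) : `|x| = (nrm x)%:C.
Proof. by rewrite /nrm RRe_real// realE normr_ge0. Qed.

Context {V : normedZmodType R[i]}.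
Implicit Types x y : V.

Lemma nrm_ge0 x : 0 <= nrm x.
Proof. by rewrite -lecR -nrmE normr_ge0. Qed.

Lemma ler_nrmD x y : nrm (x + y) <= nrm x + nrm y.
Proof. by rewrite -lecR raddfD/= -!nrmE ler_normD. Qed.

Lemma nrm0 : nrm (0 : V) = 0.
Proof. by rewrite /nrm normr0. Qed.

Lemma nrm0_eq0 x : nrm x = 0 -> x = 0.
Proof. by move=> h; apply/eqP; rewrite -normr_eq0 nrmE h. Qed.

Lemma nrmN x : nrm (- x) = nrm x.
Proof. by rewrite /nrm normrN. Qed.

Lemma nrmB x y : nrm (x - y) = nrm (y - x).
Proof. by rewrite -nrmN opprB. Qed.

Lemma ler_nrmB x y z : nrm (x - z) <= nrm (x - y) + nrm (y - z).
Proof. by apply: le_trans (ler_nrmD _ _); rewrite addrA subrK. Qed.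

Lemma ler_nrm_dist x y : `|nrm x - nrm y| <= nrm (x - y).
Proof.
rewrite ler_norml lerNl opprB !lerBlDr; apply/andP; split.
  by rewrite nrmB (le_trans _ (ler_nrmD _ _))// subrK.
by rewrite (le_trans _ (ler_nrmD _ _))// subrK.
Qed.

End Nrm.

Lemma nrmZ (R : realType) (V : normedModType R[i]) (c : R[i]) (x : V) :
  nrm (c *: x) = nrm c * nrm x.
Proof. by apply/(@complexI R); rewrite rmorphM/= -!nrmE normrZ. Qed.

Lemma nrmM (R : realType) (c d : R[i]) : nrm (c * d) = nrm c * nrm d.
Proof. exact: (@nrmZ R R[i]^o c d). Qed.

Lemma nrm1 (R : realType) : nrm (1 : R[i]) = 1.
Proof. by rewrite /nrm normr1. Qed.

Lemma nrm_real (R : realType) (x : R) : nrm (x%:C) = `|x|.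
Proof. by apply/(@complexI R); rewrite -nrmE normc_def/= expr0n/= addr0 sqrtr_sqr. Qed.

Lemma nrmV (R : realType) (c : R[i]) : c != 0 -> nrm c^-1 = (nrm c)^-1.
Proof.
move=> c0; have n0 : nrm c != 0 by apply: contraNneq c0 => /nrm0_eq0 ->.
by apply: (mulIf n0); rewrite -nrmM mulVf// nrm1 mulVf.
Qed.

Lemma subhomogeneous (R : realType) (V : lmodType R[i]) (N : V -> R) :
  (forall x, 0 <= N x) -> (forall (c : R[i]) x, N (c *: x) <= nrm c * N x) ->
  forall (c : R[i]) x, N (c *: x) = nrm c * N x.
Proof.
move=> N0 h c x; apply/eqP; rewrite eq_le h/=.
have [->|c0] := eqVneq c 0; first by rewrite nrm0 mul0r.
have n0 : 0 < nrm c.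
  by rewrite lt0r nrm_ge0 andbT; apply: contraNneq c0 => /nrm0_eq0 ->.
have := h c^-1 (c *: x); rewrite scalerK// nrmV// => hx.
by rewrite mulrC -ler_pdivlMr// mulrC.
Qed.

Definition cauchyn {R : realType} {V : zmodType} (p : V -> R) (u : nat -> V) :=
  forall e : R, 0 < e ->
    exists N, forall m n, (N <= m)%N -> (N <= n)%N -> p (u m - u n) < e.

Section SeqComplete.
Context {R : realType} (V : normedModType R[i]).

Lemma cvg0P (f : nat -> R) : (forall n, 0 <= f n) ->
  (forall e : R, 0 < e -> exists N, forall n, (N <= n)%N -> f n < e) <->
  (f @ \oo --> (0 : R)).
Proof.
move=> f0; split.
  move=> h; apply/cvgrPdist_lt => e /h[N hN].
  by exists N => // n /= Nn; rewrite sub0r normrN ger0_norm// hN.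
move=> /cvgrPdist_lt h e /h[N _ hN]; exists N => n Nn.
by have := hN n Nn; rewrite sub0r normrN ger0_norm.
Qed.

Lemma nrm_ball (x y : V) (e : R) : ball x e%:C y <-> nrm (x - y) < e.
Proof. by rewrite -ball_normE /ball_/= nrmE ltcR. Qed.

Lemma seq_complete :
  (forall u : nat -> V, cauchyn nrm u ->
     exists l, (fun n => nrm (u n - l)) @ \oo --> (0 : R)) ->
  forall F : set_system V, ProperFilter F -> cauchy F -> cvg F.
Proof.
move=> H F FF /cauchyP cF.
pose e n : R := n.+1%:R^-1.
have e0 n : 0 < e n by rewrite invr_gt0 ltr0n.
have hx n : exists x, F (ball x (e n)%:C) by apply: cF; rewrite ltcR.
have [x Fx] := choice hx.
have dx m n : nrm (x m - x n) < e m + e n.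
  have [y [/nrm_ball ym /nrm_ball yn]] := filter_ex (filterI (Fx m) (Fx n)).
  apply: le_lt_trans (ler_nrmB _ y _) _.
  by apply: ltrD => //; rewrite nrmB.
have small (d : R) : 0 < d -> exists N, forall n, (N <= n)%N -> e n < d.
  move=> d0; exists (Num.bound d^-1) => n Nn.
  rewrite /e invf_plt ?posrE// ?ltr0n//.
  apply: (lt_le_trans (archi_boundP _)); first by rewrite invr_ge0 ltW.
  by rewrite ler_nat (leq_trans Nn).
have [|l hl] := H x.
  move=> d d0; have [|N hN] := small (d / 2); first by rewrite divr_gt0.
  exists N => m n Nm Nn; apply: lt_le_trans (dx _ _) _.
  by rewrite [leRHS](splitr d) lerD// ltW// hN.
apply/cvg_ex; exists l; apply/cvg_ballP => d d0.
have dE : d = (complex.Re d)%:C by rewrite RRe_real// realE ltW.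
move: d0; rewrite dE ltcR; set r := complex.Re d => r0.
have [|N1 h1] := small (r / 2); first by rewrite divr_gt0.
have [|N2 h2] := (cvg0P (fun n => nrm_ge0 _)).2 hl (r / 2); first by rewrite divr_gt0.
pose n := maxn N1 N2.
apply: filterS (Fx n) => y /nrm_ball yn.
apply/nrm_ball; apply: le_lt_trans (ler_nrmB _ (x n) _) _.
rewrite [ltRHS](splitr r) ltrD//.
  by rewrite nrmB h2// leq_maxr.
by apply: lt_trans yn _; rewrite h1// leq_maxl.
Qed.
End SeqComplete.

Lemma complete_seq (R : realType) (V : completeNormedModType R[i]) (u : nat -> V) :
  cauchyn nrm u -> exists l, (fun n => nrm (u n - l)) @ \oo --> (0 : R).
Proof.
move=> cu.
have /cvg_ex[l ul] : cvg (u @ \oo).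
  apply: cauchy_cvg; apply/cauchy_exP => d d0.
  have dE : d = (complex.Re d)%:C by rewrite RRe_real// realE ltW.
  move: d0; rewrite dE ltcR => /cu[N hN].
  exists (u N); exists N => // n /= Nn; apply/nrm_ball; exact: hN.
exists l; apply/cvg0P => [n|e e0]; first exact: nrm_ge0.
have /cvg_ballP/(_ e%:C) := ul; rewrite ltcR => /(_ e0)[N _ hN].
by exists N => n Nn; rewrite nrmB; apply/nrm_ball; exact: hN.
Qed.

Section BoundedOperators.
Context {R : realType} (V W : normedModType R[i]).

Definition bounded_op (f : V -> W) : Prop :=
  linear f /\ exists c : R, forall x, nrm (f x) <= c * nrm x.

Definition bop_pred : {pred V -> W} := fun f => `[< bounded_op f >].

Lemma bop_predP f : reflect (bounded_op f) (f \in bop_pred).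
Proof. exact: asboolP. Qed.

Lemma bop_submod_closed : submod_closed bop_pred.
Proof.
split.
  apply/bop_predP; split; first by move=> a x y /=; rewrite scaler0 addr0.
  by exists 0 => x; rewrite nrm0 mul0r.
move=> a f g /bop_predP[lf [c hc]] /bop_predP[lg [d hd]]; apply/bop_predP; split.
  move=> b x y; rewrite !fctE lf lg !scalerDr !scalerA (mulrC a b).
  by rewrite addrACA.
exists (nrm a * c + d) => x; rewrite !fctE.
apply: le_trans (ler_nrmD _ _) _.
rewrite nrmZ mulrDl lerD// -mulrA ler_wpM2l ?nrm_ge0//.
Qed.

HB.instance Definition _ := GRing.isSubmodClosed.Build R[i] (V -> W) bop_pred
  bop_submod_closed.

Record bop := Bop { bop_fun :> V -> W; bop_funP : bop_fun \in bop_pred }.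

HB.instance Definition _ := [isSub for bop_fun].
HB.instance Definition _ := gen_eqMixin bop.
HB.instance Definition _ := gen_choiceMixin bop.
HB.instance Definition _ := [SubChoice_isSubLmodule of bop by <:].

Definition mkBop (f : V -> W) (h : bounded_op f) : bop :=
  Bop (introT (bop_predP f) h).

Lemma bop_linear (T : bop) : linear T.
Proof. by case: T => f /= /bop_predP[]. Qed.

HB.instance Definition _ (T : bop) :=
  GRing.isLinear.Build R[i] V W _ (bop_fun T) (bop_linear T).

Lemma bop_bounded (T : bop) : exists c : R, forall x, nrm (T x) <= c * nrm x.
Proof. by case: T => f /= /bop_predP[]. Qed.

Lemma bopP (S T : bop) : (forall x, S x = T x) -> S = T.
Proof. by move=> h; apply/val_inj/funext. Qed.

Lemma bopDE (S T : bop) x : (S + T) x = S x + T x. Proof. by []. Qed.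
Lemma bopZE (c : R[i]) (T : bop) x : (c *: T) x = c *: T x. Proof. by []. Qed.

Definition opnorm (T : bop) : R :=
  inf [set c : R | 0 <= c /\ forall x, nrm (T x) <= c * nrm x].

Lemma opnorm_has_inf (T : bop) :
  has_inf [set c : R | 0 <= c /\ forall x, nrm (T x) <= c * nrm x].
Proof.
split; last by exists 0 => c [].
have [c hc] := bop_bounded T; exists `|c|; split => // x.
by apply: le_trans (hc x) _; rewrite ler_wpM2r ?nrm_ge0// ler_norm.
Qed.

Lemma opnorm_ge0 T : 0 <= opnorm T.
Proof. by apply: lb_le_inf; [exact: (opnorm_has_inf T).1 | move=> c []]. Qed.

Lemma opnorm_le (T : bop) c : 0 <= c -> (forall x, nrm (T x) <= c * nrm x) ->
  opnorm T <= c.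
Proof. by move=> c0 h; apply: ge_inf => //; exact: (opnorm_has_inf T).2. Qed.

Lemma le_opnorm (T : bop) x : nrm (T x) <= opnorm T * nrm x.
Proof.
have [/eqP/nrm0_eq0 ->|x0] := boolP (nrm x == 0); first by rewrite raddf0 !nrm0 mulr0.
have {}x0 : 0 < nrm x by rewrite lt0r x0 nrm_ge0.
rewrite -ler_pdivrMr//; apply: lb_le_inf; first exact: (opnorm_has_inf T).1.
by move=> c [c0 hc]; rewrite ler_pdivrMr.
Qed.

Lemma opnormD S T : opnorm (S + T) <= opnorm S + opnorm T.
Proof.
apply: opnorm_le => [|x]; first by rewrite addr_ge0 ?opnorm_ge0.
by rewrite mulrDl; apply: le_trans (ler_nrmD _ _) (lerD _ _); exact: le_opnorm.
Qed.

Lemma opnormZ_le c T : opnorm (c *: T) <= nrm c * opnorm T.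
Proof.
apply: opnorm_le => [|x]; first by rewrite mulr_ge0 ?opnorm_ge0 ?nrm_ge0.
by rewrite bopZE nrmZ -mulrA ler_wpM2l ?nrm_ge0 ?le_opnorm.
Qed.

Lemma opnorm0_eq0 T : opnorm T = 0 -> T = 0.
Proof.
move=> h; apply: bopP => x; apply: nrm0_eq0; apply/eqP; rewrite eq_le nrm_ge0 andbT.
by have := le_opnorm T x; rewrite h mul0r.
Qed.

Lemma opnormZ c T : opnorm (c *: T) = nrm c * opnorm T.
Proof. exact: (subhomogeneous opnorm_ge0 opnormZ_le). Qed.

Let cnorm (T : bop) : R[i] := (opnorm T)%:C.
Let cnormD S T : cnorm (S + T) <= cnorm S + cnorm T.
Proof. by rewrite /cnorm -raddfD lecR opnormD. Qed.
Let cnormZ c T : cnorm (c *: T) = `|c| * cnorm T.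
Proof. by rewrite /cnorm opnormZ rmorphM/= -nrmE. Qed.
Let cnorm_eq0 T : cnorm T = 0 -> T = 0.
Proof. by move/(@complexI R)/opnorm0_eq0. Qed.

HB.instance Definition _ :=
  Lmodule_isNormed.Build R[i] bop cnormD cnormZ cnorm_eq0.

Lemma nrm_bop (T : bop) : nrm T = opnorm T.
Proof. by []. Qed.

End BoundedOperators.

Section Duality.
Context {R : realType}.
Implicit Types V W X : normedModType R[i].

Definition dual_space V : normedModType R[i] := bop V R[i]^o.

Lemma comp_bounded V W X (S : bop W X) (T : bop V W) : bounded_op (S \o T).
Proof.
split; first by move=> a x y /=; rewrite !linearP.
exists (opnorm S * opnorm T) => x /=.
apply: le_trans (le_opnorm _ _) _.
by rewrite -mulrA ler_wpM2l ?opnorm_ge0 ?le_opnorm.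
Qed.

Definition bop_comp V W X (S : bop W X) (T : bop V W) : bop V X :=
  mkBop (comp_bounded S T).

Lemma adjoint_bounded V W (T : bop V W) :
  bounded_op (fun f : dual_space W => bop_comp f T : dual_space V).
Proof.
split; first by move=> a f g; apply: bopP.
exists (opnorm T) => f; rewrite nrm_bop; apply: opnorm_le => [|x].
  by rewrite mulr_ge0 ?opnorm_ge0 ?nrm_ge0.
apply: le_trans (le_opnorm f (T x)) _.
by rewrite (mulrC (opnorm T)) -mulrA ler_wpM2l ?opnorm_ge0 ?le_opnorm.
Qed.

Definition adjoint V W (T : bop V W) : bop (dual_space W) (dual_space V) :=
  mkBop (adjoint_bounded T).

Definition biadjoint V W (T : bop V W) :
    bop (dual_space (dual_space V)) (dual_space (dual_space W)) :=
  adjoint (adjoint T).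

Lemma bidual_eval_bounded V (x : V) : bounded_op (fun f : dual_space V => f x : R[i]^o).
Proof. by split=> //; exists (nrm x) => f; rewrite mulrC; exact: le_opnorm. Qed.

Definition bidual_eval V (x : V) : dual_space (dual_space V) := mkBop (bidual_eval_bounded x).

End Duality.

Section NormConvergence.
Context {R : realType}.

Lemma squeeze0 (f g : nat -> R) : (forall n, 0 <= f n <= g n) ->
  g @ \oo --> (0 : R) -> f @ \oo --> (0 : R).
Proof.
move=> h g0; apply: (@squeeze_cvgr _ _ _ _ (cst 0) g) => //.
  by near=> n; exact: h.
exact: cvg_cst.
Unshelve. all: by end_near. Qed.

Lemma le_cvg (f g : nat -> R) (l m : R) : f @ \oo --> l -> g @ \oo --> m ->
  (exists N, forall n, (N <= n)%N -> f n <= g n) -> l <= m.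
Proof.
move=> fl gm [N h]; apply: ler_cvg_to fl gm _.
by exists N => // n; exact: h.
Qed.

Lemma cvgD_fun (f g : nat -> R) (l m : R) : f @ \oo --> l -> g @ \oo --> m ->
  (fun n => f n + g n) @ \oo --> l + m.
Proof. exact: cvgD. Qed.

Lemma cvgM_fun (c : R) (f : nat -> R) (l : R) : f @ \oo --> l ->
  (fun n => c * f n) @ \oo --> c * l.
Proof. by move=> fl; apply: cvgM => //; exact: cvg_cst. Qed.

Lemma cvg0D (f g : nat -> R) : f @ \oo --> (0 : R) -> g @ \oo --> (0 : R) ->
  (fun n => f n + g n) @ \oo --> (0 : R).
Proof. by move=> f0 g0; rewrite -[0]addr0; exact: cvgD. Qed.

Lemma cvg0M (c : R) (f : nat -> R) : f @ \oo --> (0 : R) ->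
  (fun n => c * f n) @ \oo --> (0 : R).
Proof. by move=> f0; rewrite -(mulr0 c); apply: cvgM => //; exact: cvg_cst. Qed.

Context {V : normedModType R[i]}.
Implicit Types (u v : nat -> V) (l m : V).

Definition ncvg u l := (fun n => nrm (u n - l)) @ \oo --> (0 : R).

Lemma ncvgD u v l m : ncvg u l -> ncvg v m ->
  ncvg (fun n => u n + v n) (l + m).
Proof.
move=> ul vm; apply: squeeze0 (cvg0D ul vm) => n.
by rewrite nrm_ge0/= opprD addrACA ler_nrmD.
Qed.

Lemma ncvgZ c u l : ncvg u l -> ncvg (fun n => c *: u n) (c *: l).
Proof.
move=> ul; apply: squeeze0 (cvg0M (nrm c) ul) => n.
by rewrite nrm_ge0/= -scalerBr nrmZ.
Qed.

Lemma ncvg_nrm u l : ncvg u l -> (fun n => nrm (u n)) @ \oo --> nrm l.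
Proof.
move=> ul; apply: cvg_sub0 (cvg_cst (nrm l)).
apply/cvgr0Pnorm_lt => e e0.
move/cvgr0Pnorm_lt : ul => /(_ e e0); apply: filterS => n /=.
rewrite (ger0_norm (nrm_ge0 _)); apply: le_lt_trans.
exact: ler_nrm_dist.
Qed.

Lemma ncvg_uniq u l m : ncvg u l -> ncvg u m -> l = m.
Proof.
move=> ul um; have ulm : ncvg (fun=> 0) (l - m).
  have := ncvgD ul (ncvgZ (-1) um); rewrite scaleN1r.
  by congr (ncvg _ _); apply/funext => n; rewrite scaleN1r subrr.
have := ncvg_nrm ulm; rewrite nrm0 => /(cvg_unique _ (cvg_cst _)) h.
by apply/subr0_eq/nrm0_eq0; rewrite -h.
Qed.

End NormConvergence.

Record seminorm (R : realType) (V : lmodType R[i]) := Seminorm {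
  snorm :> V -> R;
  snormD : forall x y, snorm (x + y) <= snorm x + snorm y;
  snormZ : forall (c : R[i]) x, snorm (c *: x) = nrm c * snorm x }.

Section SeminormTheory.
Context {R : realType} {V : lmodType R[i]} (p : seminorm V).

Lemma snorm0 : p 0 = 0.
Proof. by rewrite -(scale0r (0 : V)) snormZ nrm0 mul0r. Qed.

Lemma snormN x : p (- x) = p x.
Proof. by rewrite -scaleN1r snormZ nrmN nrm1 mul1r. Qed.

Lemma snormB x y : p (x - y) = p (y - x).
Proof. by rewrite -snormN opprB. Qed.

Lemma snorm_ge0 x : 0 <= p x.
Proof.
have := snormD p x (- x); rewrite subrr snorm0 snormN -mulr2n.
by rewrite pmulrn_lge0.
Qed.

Lemma ler_snormB x y z : p (x - z) <= p (x - y) + p (y - z).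
Proof. by apply: le_trans (snormD _ _ _); rewrite addrA subrK. Qed.

Lemma ler_snorm_dist x y : `|p x - p y| <= p (x - y).
Proof.
rewrite ler_norml lerNl opprB !lerBlDr; apply/andP; split.
  by rewrite snormB (le_trans _ (snormD _ _ _))// subrK.
by rewrite (le_trans _ (snormD _ _ _))// subrK.
Qed.

End SeminormTheory.

(** the normed space obtained from a seminormed one by identifying the points
    at distance zero *)
Section Separation.
Context {R : realType} {V : lmodType R[i]} (p : seminorm V).

Definition sep_rel (x y : V) : bool := p (x - y) == 0.

Lemma sep_rel_equiv : equiv_class_of sep_rel.
Proof.
split=> [x|x y|y x z]; rewrite /sep_rel.
- by rewrite subrr snorm0.
- by rewrite snormB.
- move=> /eqP xy /eqP yz; rewrite eq_le snorm_ge0 andbT.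
  by rewrite (le_trans (ler_snormB _ _ y _))// xy yz addr0.
Qed.

Canonical sep_equiv := EquivRelPack sep_rel_equiv.

Definition sep := {eq_quot sep_equiv}.
HB.instance Definition _ := Choice.on sep.
HB.instance Definition _ := EqQuotient.on sep.

Definition sep_pi (x : V) : sep := \pi_sep x.

Lemma sep_piP x y : sep_pi x = sep_pi y <-> p (x - y) = 0.
Proof. by split=> [/eqmodP/eqP|/eqP h]; [|apply/eqmodP]. Qed.

Lemma sep_reprK (q : sep) : sep_pi (repr q) = q.
Proof. exact: reprK. Qed.

Lemma sep_repr x : p (repr (sep_pi x) - x) = 0.
Proof. by apply/sep_piP; rewrite sep_reprK. Qed.

Lemma sep_ind (P : sep -> Prop) : (forall x, P (sep_pi x)) -> forall q, P q.
Proof. by move=> h q; rewrite -(sep_reprK q). Qed.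

Definition sep_add (q r : sep) : sep := sep_pi (repr q + repr r).
Definition sep_opp (q : sep) : sep := sep_pi (- repr q).
Definition sep_scale (c : R[i]) (q : sep) : sep := sep_pi (c *: repr q).
Definition sep_norm (q : sep) : R := p (repr q).

Lemma sep_addE x y : sep_add (sep_pi x) (sep_pi y) = sep_pi (x + y).
Proof.
apply/sep_piP/eqP; rewrite eq_le snorm_ge0 andbT opprD addrACA.
by rewrite (le_trans (snormD _ _ _))// !sep_repr addr0.
Qed.

Lemma sep_scaleE c x : sep_scale c (sep_pi x) = sep_pi (c *: x).
Proof. by apply/sep_piP; rewrite -scalerBr snormZ sep_repr mulr0. Qed.

Lemma sep_oppE x : sep_opp (sep_pi x) = sep_pi (- x).
Proof. by apply/sep_piP; rewrite -opprD snormN sep_repr. Qed.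

Lemma sep_normE x : sep_norm (sep_pi x) = p x.
Proof.
apply/eqP; rewrite -subr_eq0 -normr_le0.
by rewrite (le_trans (ler_snorm_dist _ _ _))// sep_repr.
Qed.

Lemma sep_addA : associative sep_add.
Proof.
by elim/sep_ind=> x; elim/sep_ind=> y; elim/sep_ind=> z; rewrite !sep_addE addrA.
Qed.

Lemma sep_addC : commutative sep_add.
Proof. by elim/sep_ind=> x; elim/sep_ind=> y; rewrite !sep_addE addrC. Qed.

Lemma sep_add0 : left_id (sep_pi 0) sep_add.
Proof. by elim/sep_ind=> x; rewrite sep_addE add0r. Qed.

Lemma sep_addN : left_inverse (sep_pi 0) sep_opp sep_add.
Proof. by elim/sep_ind=> x; rewrite sep_oppE sep_addE addNr. Qed.

HB.instance Definition _ :=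
  GRing.isZmodule.Build sep sep_addA sep_addC sep_add0 sep_addN.

Lemma sep_scaleA c d q : sep_scale c (sep_scale d q) = sep_scale (c * d) q.
Proof. by elim/sep_ind: q => x; rewrite !sep_scaleE scalerA. Qed.

Lemma sep_scale1 : left_id 1 sep_scale.
Proof. by elim/sep_ind=> x; rewrite sep_scaleE scale1r. Qed.

Lemma sep_scaleDr : right_distributive sep_scale +%R.
Proof.
move=> c; elim/sep_ind=> x; elim/sep_ind=> y.
by rewrite [_ + _]sep_addE !sep_scaleE scalerDr; exact/esym/sep_addE.
Qed.

Lemma sep_scaleDl q : {morph sep_scale^~ q : c d / c + d}.
Proof.
move=> c d; elim/sep_ind: q => x.
by rewrite !sep_scaleE scalerDl; exact/esym/sep_addE.
Qed.

HB.instance Definition _ := GRing.Zmodule_isLmodule.Build R[i] sep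
  sep_scaleA sep_scale1 sep_scaleDr sep_scaleDl.

Let cnorm (q : sep) : R[i] := (sep_norm q)%:C.
Let cnormD q r : cnorm (q + r) <= cnorm q + cnorm r.
Proof.
rewrite /cnorm -raddfD lecR; elim/sep_ind: q => x; elim/sep_ind: r => y.
by rewrite [_ + _]sep_addE !sep_normE snormD.
Qed.
Let cnormZ c q : cnorm (c *: q) = `|c| * cnorm q.
Proof.
rewrite /cnorm nrmE -rmorphM/=; congr (_ %:C); elim/sep_ind: q => x.
by rewrite [_ *: _]sep_scaleE !sep_normE snormZ.
Qed.
Let cnorm_eq0 q : cnorm q = 0 -> q = 0.
Proof.
move/(@complexI R); elim/sep_ind: q => x; rewrite sep_normE => x0.
by apply/sep_piP; rewrite subr0.
Qed.

HB.instance Definition _ :=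
  Lmodule_isNormed.Build R[i] sep cnormD cnormZ cnorm_eq0.

Lemma sep_pi_linear : linear sep_pi.
Proof.
by move=> c x y; rewrite -[LHS]sep_addE; congr (_ + _); rewrite -[LHS]sep_scaleE.
Qed.

HB.instance Definition _ :=
  GRing.isLinear.Build R[i] V sep _ sep_pi sep_pi_linear.

Lemma nrm_sep_pi x : nrm (sep_pi x) = p x.
Proof. exact: sep_normE. Qed.

End Separation.

Section Completion.
Context {R : realType} {V : lmodType R[i]} (p : seminorm V).

Definition cauchy_pred : {pred nat -> V} := fun u => `[< cauchyn p u >].

Lemma cauchy_predP u : reflect (cauchyn p u) (u \in cauchy_pred).
Proof. exact: asboolP. Qed.

Lemma cauchy_submod_closed : submod_closed cauchy_pred.
Proof.
split.
  by apply/cauchy_predP => e e0; exists 0%N => m n _ _; rewrite subrr snorm0.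
move=> c u v /cauchy_predP cu /cauchy_predP cv; apply/cauchy_predP => e e0.
pose d := e / 2 / (nrm c + 1).
have c1 : 0 < nrm c + 1 by rewrite ltr_wpDl ?nrm_ge0.
have d0 : 0 < d by rewrite /d !divr_gt0.
have [N hN] := cu d d0; have [|M hM] := cv (e / 2); first by rewrite divr_gt0.
exists (maxn N M) => m n; rewrite !geq_max => /andP[Nm Mm] /andP[Nn Mn].
rewrite !fctE opprD addrACA -scalerBr.
apply: le_lt_trans (snormD _ _ _) _.
rewrite [ltRHS](splitr e) ler_ltD ?hM// snormZ.
have -> : e / 2 = (nrm c + 1) * d by rewrite /d mulrCA divff ?mulr1// gt_eqF.
by rewrite ler_pM ?nrm_ge0 ?snorm_ge0 ?lerDl// ltW// hN.
Qed.

HB.instance Definition _ := GRing.isSubmodClosed.Build R[i] (nat -> V)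
  cauchy_pred cauchy_submod_closed.

Record cseq := CSeq { cseq_fun :> nat -> V; cseqP : cseq_fun \in cauchy_pred }.

HB.instance Definition _ := [isSub for cseq_fun].
HB.instance Definition _ := gen_eqMixin cseq.
HB.instance Definition _ := gen_choiceMixin cseq.
HB.instance Definition _ := [SubChoice_isSubLmodule of cseq by <:].

Definition mkCseq u (h : cauchyn p u) : cseq := CSeq (introT (cauchy_predP u) h).

Lemma cseq_cauchy (u : cseq) : cauchyn p u.
Proof. exact/cauchy_predP/cseqP. Qed.

Definition clim (u : cseq) : R := lim ((fun n => p (u n)) @ \oo).

Lemma cvg_clim (u : cseq) : (fun n => p (u n)) @ \oo --> clim u.
Proof.
suff [l hl] : exists l, (fun n => nrm ((p (u n))%:C - l : R[i]^o)) @ \oo --> (0 : R).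
  apply/cvg_ex; exists (complex.Re l); apply: cvg_sub0 (cvg_cst _).
  apply/cvgr0Pnorm_lt => e e0; move/cvgr0Pnorm_lt : hl => /(_ e e0).
  apply: filterS => n /=; apply: le_lt_trans.
  rewrite (ger0_norm (nrm_ge0 _)) -lecR -nrmE.
  by apply: le_trans (normc_ge_Re _); rewrite raddfB.
suff /cauchy_cvgP : cauchy ((fun n => p (u n)) @ \oo).
  move=> /cvg_ex[l hl]; exists l%:C; apply/cvg0P => [n|e e0]; first exact: nrm_ge0.
  move/cvgrPdist_lt : hl => /(_ e e0)[N _ hN]; exists N => n Nn.
  by rewrite -raddfB nrm_real distrC; exact: hN.
apply/cauchy_exP => e e0; have [N hN] := cseq_cauchy u e0.
exists (p (u N)); exists N => // n /= Nn; rewrite -ball_normE /=.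
by apply: le_lt_trans (ler_snorm_dist _ _ _) _; exact: hN.
Qed.

Arguments cvg_clim u : clear implicits.

Lemma climD u v : clim (u + v) <= clim u + clim v.
Proof.
apply: le_cvg (cvg_clim (u + v)) (cvgD_fun (cvg_clim u) (cvg_clim v)) _.
by exists 0%N => n _; exact: snormD.
Qed.

Lemma climZ (c : R[i]) u : clim (c *: u) = nrm c * clim u.
Proof.
apply: (@cvg_unique _ (@Rhausdorff R) _ _ _ _ (cvg_clim _)).
rewrite (_ : (fun n => _) = (fun n => nrm c * p (u n))); last first.
  by apply/funext => n; exact: snormZ.
exact: cvgM_fun (cvg_clim u).
Qed.

Definition clim_seminorm : seminorm cseq := Seminorm climD climZ.

(** the Banach space completion of a seminormed space: Cauchy sequences modulo
    null sequences *)
Definition completion : Type := sep clim_seminorm.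

HB.instance Definition _ := NormedModule.on completion.

Lemma completion_ind (P : completion -> Prop) :
  (forall u, P (sep_pi clim_seminorm u)) -> forall x, P x.
Proof. exact: sep_ind. Qed.

Lemma const_cauchy (v : V) : cauchyn p (fun=> v).
Proof. by move=> e e0; exists 0%N => m n _ _; rewrite subrr snorm0. Qed.

Definition inj_completion (v : V) : completion :=
  sep_pi clim_seminorm (mkCseq (const_cauchy v)).

Lemma inj_completion_linear : linear inj_completion.
Proof.
move=> c x y; rewrite /inj_completion -sep_pi_linear; congr sep_pi.
exact/val_inj.
Qed.

HB.instance Definition _ := GRing.isLinear.Build R[i] V completion _
  inj_completion inj_completion_linear.

Lemma clim_const (u : cseq) (c : R) : (forall n, p (u n) = c) -> clim u = c.
Proof.
move=> h; apply: (@cvg_unique _ (@Rhausdorff R) _ _ _ _ (cvg_clim _)).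
by rewrite (_ : (fun n => _) = cst c); [exact: cvg_cst|exact/funext].
Qed.

Lemma nrm_inj_completion v : nrm (inj_completion v) = p v.
Proof. by rewrite [LHS]nrm_sep_pi; exact: clim_const. Qed.

Lemma completion_cvg (u : cseq) :
  ncvg (fun n => inj_completion (u n)) (sep_pi clim_seminorm u : completion).
Proof.
apply/cvg0P => [n|e e0]; first exact: nrm_ge0.
have [|N hN] := cseq_cauchy u (e := e / 2); first by rewrite divr_gt0.
exists N => n Nn; rewrite /inj_completion -raddfB [nrm _]nrm_sep_pi.
rewrite (@le_lt_trans _ _ (e / 2))//; last by rewrite ltr_pdivrMr// ltr_pMr// ltr1n.
apply: le_cvg (cvg_clim _) (cvg_cst (e / 2)) _.
by exists N => m Nm; apply/ltW/hN.
Qed.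

Arguments completion_cvg u : clear implicits.

Lemma completion_dense (x : completion) (e : R) : 0 < e ->
  exists v, nrm (inj_completion v - x) < e.
Proof.
elim/completion_ind: x => u e0.
have /cvg0P/(_ e e0)[|N hN] := completion_cvg u; first by move=> n; exact: nrm_ge0.
by exists (u N); exact: hN.
Qed.

Lemma completion_seq_complete (U : nat -> completion) : cauchyn nrm U ->
  exists l, (fun n => nrm (U n - l)) @ \oo --> (0 : R).
Proof.
move=> cU; pose e n : R := n.+1%:R^-1.
have e0 n : 0 < e n by rewrite invr_gt0 ltr0n.
have [v hv] := choice (fun n => completion_dense (U n) (e0 n)).
have small (d : R) : 0 < d -> exists N, forall n, (N <= n)%N -> e n < d.
  move=> d0; exists (Num.bound d^-1) => n Nn.
  rewrite /e invf_plt ?posrE// ?ltr0n//.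
  apply: (lt_le_trans (archi_boundP _)); first by rewrite invr_ge0 ltW.
  by rewrite ler_nat (leq_trans Nn).
have cv : cauchyn p v.
  move=> d d0; have d3 : 0 < d / 3 by rewrite divr_gt0.
  have [N hN] := small _ d3; have [M hM] := cU _ d3.
  exists (maxn N M) => m n; rewrite !geq_max => /andP[Nm Mm] /andP[Nn Mn].
  rewrite -nrm_inj_completion raddfB.
  apply: le_lt_trans (ler_nrmB _ (U m) _) _.
  have -> : d = d / 3 + (d / 3 + d / 3) by field.
  rewrite ltrD ?(lt_trans (hv m) (hN _ Nm))//.
  apply: le_lt_trans (ler_nrmB _ (U n) _) _.
  apply: ltrD; first exact: hM.
  by rewrite nrmB; exact: lt_trans (hv n) (hN _ Nn).
exists (sep_pi clim_seminorm (mkCseq cv)).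
have e_cvg : e @ \oo --> (0 : R) by apply/cvg0P => // n; rewrite ltW.
apply: squeeze0 (cvg0D e_cvg (completion_cvg (mkCseq cv))) => n.
rewrite nrm_ge0/=; apply: le_trans (ler_nrmB _ (inj_completion (v n)) _) _.
by rewrite lerD2r nrmB ltW.
Qed.

HB.instance Definition _ := Uniform_isComplete.Build completion
  (seq_complete completion_seq_complete).

Section Extension.
Context {G : completeNormedModType R[i]} (T : V -> G).
Hypothesis Tlin : linear T.
Hypothesis Tbnd : exists c : R, forall v, nrm (T v) <= c * p v.

Let TB x y : T (x - y) = T x - T y.
Proof. by rewrite addrC -scaleN1r Tlin scaleN1r addrC. Qed.

Let bnd : {c : R | 0 <= c /\ forall v, nrm (T v) <= c * p v}.
Proof.
apply: cid; have [c hc] := Tbnd; exists `|c|; split => // v.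
by apply: le_trans (hc v) _; rewrite ler_wpM2r ?snorm_ge0// ler_norm.
Qed.

Lemma ext_cvg (u : cseq) : exists l, ncvg (fun n => T (u n)) l.
Proof.
apply: complete_seq => e e0; have [c [c0 hc]] := bnd.
have c1 : 0 < c + 1 by rewrite ltr_wpDl.
have [|N hN] := cseq_cauchy u (e := e / (c + 1)); first by rewrite divr_gt0.
exists N => m n Nm Nn; rewrite -TB; apply: le_lt_trans (hc _) _.
apply: (@le_lt_trans _ _ ((c + 1) * p (u m - u n))).
  by rewrite ler_wpM2r ?snorm_ge0// lerDl.
by rewrite mulrC -ltr_pdivlMr// hN.
Qed.

Definition ext_lim (u : cseq) : G := sval (cid (ext_cvg u)).

Lemma ext_limP (u : cseq) : ncvg (fun n => T (u n)) (ext_lim u).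
Proof. exact: svalP (cid (ext_cvg u)). Qed.

Arguments ext_limP u : clear implicits.

Lemma ext_lim_linear : linear ext_lim.
Proof.
move=> c u v; apply: ncvg_uniq (ext_limP _) _.
rewrite (_ : (fun n => _) = (fun n => c *: T (u n) + T (v n))); last first.
  by apply/funext => n; rewrite -Tlin.
by apply: ncvgD; [apply: ncvgZ|]; exact: ext_limP.
Qed.

Lemma ext_lim_le (c : R) (u : cseq) : (forall v, nrm (T v) <= c * p v) ->
  nrm (ext_lim u) <= c * clim u.
Proof.
move=> hc; apply: le_cvg (ncvg_nrm (ext_limP u)) (cvgM_fun (c := c) (cvg_clim u)) _.
by exists 0%N => n _; exact: hc.
Qed.

Definition ext_fun (x : completion) : G := ext_lim (repr x).

Lemma ext_fun_pi u : ext_fun (sep_pi clim_seminorm u) = ext_lim u.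
Proof.
apply/subr0_eq/nrm0_eq0/eqP; rewrite eq_le nrm_ge0 andbT.
have [c [_ hc]] := bnd.
have -> : ext_fun (sep_pi clim_seminorm u) - ext_lim u =
    ext_lim (repr (sep_pi clim_seminorm u) - u).
  by rewrite [in RHS]addrC -scaleN1r ext_lim_linear scaleN1r addrC.
have h0 : clim (repr (sep_pi clim_seminorm u) - u) = 0 := sep_repr clim_seminorm u.
by apply: le_trans (ext_lim_le _ hc) _; rewrite h0 mulr0.
Qed.

Lemma ext_le (c : R) x : (forall v, nrm (T v) <= c * p v) ->
  nrm (ext_fun x) <= c * nrm x.
Proof.
move=> hc; elim/completion_ind: x => u; rewrite ext_fun_pi [nrm (sep_pi _ _)]nrm_sep_pi.
exact: ext_lim_le.
Qed.

Lemma ext_bounded : bounded_op ext_fun.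
Proof.
split; last by have [c hc] := Tbnd; exists c => x; exact: ext_le.
move=> c; elim/completion_ind => u; elim/completion_ind => v.
by rewrite -sep_pi_linear !ext_fun_pi ext_lim_linear.
Qed.

Definition extension : bop completion G := mkBop ext_bounded.

Lemma extensionE v : extension (inj_completion v) = T v.
Proof.
rewrite [LHS]ext_fun_pi; apply: ncvg_uniq (ext_limP _) _.
by apply/cvg0P => [n|e e0]; [exact: nrm_ge0|exists 0%N => n _; rewrite subrr nrm0].
Qed.

End Extension.

End Completion.

(** The algebraic tensor product: formal sums [\sum_k v_k (x) w_k], where two
    sums are identified when every bilinear map takes the same value on them.
    Scalars are absorbed in the left factors. *)
Section AlgebraicTensor.
Context {R : realType} (V W : lmodType R[i]).

Definition bilinear_map (G : lmodType R[i]) (phi : V -> W -> G) : Prop :=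
  (forall w, linear (phi^~ w)) /\ (forall v, linear (phi v)).

Lemma bilinear_mapZl (G : lmodType R[i]) (phi : V -> W -> G) c v w :
  bilinear_map phi -> phi (c *: v) w = c *: phi v w.
Proof.
move=> [hl _].
have phi0 : phi 0 w = 0.
  by have := hl w (-1) 0 0; rewrite /= scaleN1r oppr0 add0r scaleN1r addNr.
by have := hl w c v 0; rewrite addr0 phi0 addr0.
Qed.

Definition fsum (G : lmodType R[i]) (phi : V -> W -> G) (s : seq (V * W)) : G :=
  \sum_(t <- s) phi t.1 t.2.

Definition talg_rel (s t : seq (V * W)) : bool :=
  `[< forall (G : lmodType R[i]) (phi : V -> W -> G), bilinear_map phi ->
        fsum phi s = fsum phi t >].

Lemma talg_rel_equiv : equiv_class_of talg_rel.
Proof.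
split=> [s|s t|t s u]; rewrite /talg_rel.
- by apply/asboolP.
- by apply/asboolP/asboolP => h G phi hphi; rewrite h.
- by move=> /asboolP h1 /asboolP h2; apply/asboolP => G phi hphi; rewrite h1// h2.
Qed.

Canonical talg_equiv := EquivRelPack talg_rel_equiv.

Definition talg := {eq_quot talg_equiv}.
HB.instance Definition _ := Choice.on talg.
HB.instance Definition _ := EqQuotient.on talg.

Definition talg_pi (s : seq (V * W)) : talg := \pi_talg s.

Lemma talg_piP s t : talg_pi s = talg_pi t <->
  forall (G : lmodType R[i]) (phi : V -> W -> G), bilinear_map phi ->
    fsum phi s = fsum phi t.
Proof. by split=> [/eqmodP/asboolP|h] //; apply/eqmodP/asboolP. Qed.

Lemma talg_ind (P : talg -> Prop) : (forall s, P (talg_pi s)) -> forall q, P q.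
Proof. by move=> h q; rewrite -[q]reprK. Qed.

Lemma talg_repr s (G : lmodType R[i]) (phi : V -> W -> G) :
  bilinear_map phi -> fsum phi (repr (talg_pi s)) = fsum phi s.
Proof. exact: (talg_piP _ _).1 (reprK (talg_pi s)) G phi. Qed.

Definition fscale (c : R[i]) (s : seq (V * W)) := [seq (c *: t.1, t.2) | t <- s].

Lemma fsum_cat G phi s t : @fsum G phi (s ++ t) = fsum phi s + fsum phi t.
Proof. exact: big_cat. Qed.

Lemma fsum_scale c s (G : lmodType R[i]) (phi : V -> W -> G) :
  bilinear_map phi -> fsum phi (fscale c s) = c *: fsum phi s.
Proof.
move=> h; rewrite /fsum big_map scaler_sumr; apply: eq_bigr => t _ /=.
exact: bilinear_mapZl.
Qed.

Definition talg_add (q r : talg) : talg := talg_pi (repr q ++ repr r).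
Definition talg_scale (c : R[i]) (q : talg) : talg := talg_pi (fscale c (repr q)).
Definition talg_opp (q : talg) : talg := talg_scale (-1) q.

Lemma talg_addE s t : talg_add (talg_pi s) (talg_pi t) = talg_pi (s ++ t).
Proof. by apply/talg_piP => G phi h; rewrite !fsum_cat !talg_repr. Qed.

Lemma talg_scaleE c s : talg_scale c (talg_pi s) = talg_pi (fscale c s).
Proof. by apply/talg_piP => G phi h; rewrite !fsum_scale// talg_repr. Qed.

Lemma talg_addA : associative talg_add.
Proof.
elim/talg_ind=> x; elim/talg_ind=> y; elim/talg_ind=> z.
by rewrite !talg_addE catA.
Qed.

Lemma talg_addC : commutative talg_add.
Proof.
elim/talg_ind=> x; elim/talg_ind=> y; rewrite !talg_addE.
by apply/talg_piP => G phi h; rewrite !fsum_cat addrC.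
Qed.

Lemma talg_add0 : left_id (talg_pi [::]) talg_add.
Proof. by elim/talg_ind=> x; rewrite talg_addE. Qed.

Lemma talg_addN : left_inverse (talg_pi [::]) talg_opp talg_add.
Proof.
elim/talg_ind=> x; rewrite /talg_opp talg_scaleE talg_addE.
apply/talg_piP => G phi h.
by rewrite fsum_cat fsum_scale// scaleN1r addNr /fsum big_nil.
Qed.

HB.instance Definition _ :=
  GRing.isZmodule.Build talg talg_addA talg_addC talg_add0 talg_addN.

Lemma talg_scaleA c d q : talg_scale c (talg_scale d q) = talg_scale (c * d) q.
Proof.
elim/talg_ind: q => x; rewrite !talg_scaleE.
by apply/talg_piP => G phi h; rewrite !fsum_scale// scalerA.
Qed.

Lemma talg_scale1 : left_id 1 talg_scale.
Proof.
elim/talg_ind=> x; rewrite talg_scaleE.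
by apply/talg_piP => G phi h; rewrite fsum_scale// scale1r.
Qed.

Lemma talg_scaleDr : right_distributive talg_scale +%R.
Proof.
move=> c; elim/talg_ind=> x; elim/talg_ind=> y.
rewrite [_ + _]talg_addE !talg_scaleE [RHS]talg_addE.
by apply/talg_piP => G phi h; rewrite fsum_cat !fsum_scale// fsum_cat scalerDr.
Qed.

Lemma talg_scaleDl q : {morph talg_scale^~ q : c d / c + d}.
Proof.
move=> c d; elim/talg_ind: q => x; rewrite !talg_scaleE [RHS]talg_addE.
by apply/talg_piP => G phi h; rewrite fsum_cat !fsum_scale// scalerDl.
Qed.

HB.instance Definition _ := GRing.Zmodule_isLmodule.Build R[i] talg
  talg_scaleA talg_scale1 talg_scaleDr talg_scaleDl.

Definition talg_lift (G : lmodType R[i]) (phi : V -> W -> G) (u : talg) : G :=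
  fsum phi (repr u).

Section Lift.
Context {G : lmodType R[i]} (phi : V -> W -> G).
Hypothesis hphi : bilinear_map phi.

Lemma talg_lift_pi s : talg_lift phi (talg_pi s) = fsum phi s.
Proof. exact: talg_repr. Qed.

Lemma talg_lift_linear : linear (talg_lift phi).
Proof.
move=> c; elim/talg_ind=> x; elim/talg_ind=> y.
rewrite [c *: _]talg_scaleE [_ + _]talg_addE !talg_lift_pi.
by rewrite fsum_cat fsum_scale.
Qed.

End Lift.

End AlgebraicTensor.

Section ProjectiveTensor.
Context {R : realType} (V W : normedModType R[i]).
Local Notation talg := (talg V W).

Definition fcost (s : seq (V * W)) : R := \sum_(t <- s) nrm t.1 * nrm t.2.

(** the projective norm [inf { \sum_k |v_k| |w_k| : u = \sum_k v_k (x) w_k }] *)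
Definition projnorm (u : talg) : R :=
  inf [set fcost s | s in [set s | talg_pi s = u]].

Lemma fcost_ge0 s : 0 <= fcost s.
Proof. by apply: sumr_ge0 => t _; rewrite mulr_ge0 ?nrm_ge0. Qed.

Lemma projnorm_has_inf u : has_inf [set fcost s | s in [set s | talg_pi s = u]].
Proof.
split; last by exists 0 => _ [s _ <-]; exact: fcost_ge0.
by elim/(@talg_ind R V W): u => s; exists (fcost s), s.
Qed.

Lemma projnorm_le s : projnorm (talg_pi s) <= fcost s.
Proof. by apply: ge_inf; [exact: (projnorm_has_inf _).2|exists s]. Qed.

Lemma projnorm_ge u (c : R) : (forall s, talg_pi s = u -> c <= fcost s) ->
  c <= projnorm u.
Proof.
move=> h; apply: lb_le_inf; first exact: (projnorm_has_inf u).1.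
by move=> _ [s /h hs <-].
Qed.

Lemma projnormD u v : projnorm (u + v) <= projnorm u + projnorm v.
Proof.
rewrite -lerBlDr; apply: projnorm_ge => s <-.
rewrite lerBlDr -lerBlDl; apply: projnorm_ge => t <-.
rewrite lerBlDl -[X in projnorm X]/(talg_add _ _) talg_addE.
apply: le_trans (projnorm_le _) _.
by rewrite /fcost big_cat.
Qed.

Lemma projnormZ_le (c : R[i]) u : projnorm (c *: u) <= nrm c * projnorm u.
Proof.
have [->|c0] := eqVneq c 0.
  by rewrite scale0r nrm0 mul0r; apply: le_trans (projnorm_le [::]) _; rewrite /fcost big_nil.
have n0 : 0 < nrm c.
  by rewrite lt0r nrm_ge0 andbT; apply: contraNneq c0 => /nrm0_eq0 ->.
rewrite -ler_pdivrMl//; apply: projnorm_ge => s <-; rewrite ler_pdivrMl//.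
rewrite [c *: _]talg_scaleE; apply: le_trans (projnorm_le _) _.
rewrite /fcost big_map mulr_sumr; apply: ler_sum => t _ /=.
by rewrite nrmZ mulrA.
Qed.

Lemma projnorm_ge0 u : 0 <= projnorm u.
Proof. by apply: projnorm_ge => s _; exact: fcost_ge0. Qed.

Lemma projnormZ (c : R[i]) u : projnorm (c *: u) = nrm c * projnorm u.
Proof. exact: (subhomogeneous projnorm_ge0 projnormZ_le). Qed.

Definition proj_seminorm : seminorm talg := Seminorm projnormD projnormZ.

Definition ptens : completeNormedModType R[i] := completion proj_seminorm.

Definition tens (v : V) (w : W) : ptens :=
  inj_completion proj_seminorm (talg_pi [:: (v, w)]).

Lemma tens_bilinear : bilinear_map tens.
Proof.
split=> [w c x y|v c x y]; rewrite /tens -inj_completion_linear;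
    congr inj_completion; rewrite [c *: talg_pi _]talg_scaleE [RHS]talg_addE;
    apply/talg_piP => G phi hphi; rewrite /fsum !big_cons !big_nil !addr0/=.
  by rewrite hphi.1 -(bilinear_mapZl _ _ _ hphi).
by rewrite hphi.2 (bilinear_mapZl _ _ _ hphi).
Qed.

Lemma nrm_tens_le v w : nrm (tens v w) <= nrm v * nrm w.
Proof.
rewrite [leLHS]nrm_inj_completion; apply: le_trans (projnorm_le _) _.
by rewrite /fcost big_cons big_nil addr0.
Qed.

Definition bounded_bilinear (G : normedModType R[i]) (phi : V -> W -> G) : Prop :=
  bilinear_map phi /\ exists c : R, forall v w, nrm (phi v w) <= c * (nrm v * nrm w).

Section Lift.
Context {G : completeNormedModType R[i]} (phi : V -> W -> G).

Lemma talg_lift_le (c : R) : bilinear_map phi -> 0 <= c ->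
  (forall v w, nrm (phi v w) <= c * (nrm v * nrm w)) ->
  forall u, nrm (talg_lift phi u) <= c * projnorm u.
Proof.
move=> hphi c0 hc u; have [c00|cn0] := eqVneq c 0.
  rewrite c00 mul0r; elim/(@talg_ind R V W): u => s; rewrite talg_lift_pi//.
  rewrite /fsum big1 ?nrm0// => t _; apply/nrm0_eq0/eqP.
  by rewrite eq_le nrm_ge0 andbT (le_trans (hc _ _))// c00 mul0r.
have {}c0 : 0 < c by rewrite lt0r cn0.
rewrite -ler_pdivrMl//; apply: projnorm_ge => s <-; rewrite ler_pdivrMl//.
rewrite talg_lift_pi// /fsum /fcost mulr_sumr.
elim/big_rec2: _ => [|t x y _ h]; first by rewrite nrm0.
by apply: le_trans (ler_nrmD _ _) _; rewrite lerD.
Qed.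

Hypothesis hphi : bounded_bilinear phi.

Let lin : linear (talg_lift phi).
Proof. exact: (talg_lift_linear hphi.1). Qed.

Let bnd : exists c : R, forall u, nrm (talg_lift phi u) <= c * proj_seminorm u.
Proof.
have [hl [c hc]] := hphi; exists `|c|; apply: talg_lift_le => // v w.
by apply: le_trans (hc v w) _; rewrite ler_wpM2r ?mulr_ge0 ?nrm_ge0// ler_norm.
Qed.

Definition ptens_lift : bop ptens G := extension lin bnd.

Lemma ptens_liftE v w : ptens_lift (tens v w) = phi v w.
Proof.
rewrite [LHS]extensionE talg_lift_pi; last exact: hphi.1.
by rewrite /fsum big_cons big_nil addr0.
Qed.

Lemma nrm_ptens_lift (c : R) : 0 <= c ->
  (forall v w, nrm (phi v w) <= c * (nrm v * nrm w)) -> nrm ptens_lift <= c.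
Proof.
move=> c0 hc; apply: opnorm_le => // x; apply: ext_le.
exact: (talg_lift_le hphi.1).
Qed.

End Lift.

Lemma ptens_ext (G : normedModType R[i]) (S T : bop ptens G) :
  (forall v w, S (tens v w) = T (tens v w)) -> S = T.
Proof.
move=> h.
have hinj s : (S - T) (inj_completion proj_seminorm (talg_pi s)) = 0.
  elim: s => [|[v w] s ih]; first by rewrite [talg_pi _]/(0 : talg) !raddf0.
  have -> : talg_pi ((v, w) :: s) = talg_pi [:: (v, w)] + talg_pi s.
    exact/esym/talg_addE.
  rewrite (raddfD (inj_completion proj_seminorm)) (raddfD (S - T)).
  rewrite -[RHS]addr0; congr (_ + _); last exact: ih.
  by apply/eqP; rewrite subr_eq0; apply/eqP; exact: h.
apply: subr0_eq; apply: bopP => x; apply: nrm0_eq0; apply/eqP.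
rewrite eq_le nrm_ge0 andbT; apply/ler_addgt0Pl => e e0.
have n1 : 0 < opnorm (S - T) + 1 by rewrite ltr_wpDl ?opnorm_ge0.
have [|u] := completion_dense x (e := e / (opnorm (S - T) + 1)); first by rewrite divr_gt0.
elim/(@talg_ind R V W): u => s hs.
rewrite -[X in nrm X]subr0 -(hinj s) -raddfB.
apply: le_trans (le_opnorm _ _) _; rewrite nrmB addr0.
apply: (@le_trans _ _ ((opnorm (S - T) + 1) * nrm (inj_completion proj_seminorm (talg_pi s) - x))).
  by rewrite ler_wpM2r ?nrm_ge0// lerDl.
by rewrite mulrC -ler_pdivlMr// ltW.
Qed.

End ProjectiveTensor.

(** No unit is required. *)
HB.mixin Record CompleteNormedModule_isBanachAlgebra (K : numFieldType) A
    of CompleteNormedModule K A := {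
  bmul : A -> A -> A;
  bmulA : associative bmul;
  bmulDl : left_distributive bmul +%R;
  bmulDr : right_distributive bmul +%R;
  bmulZl : forall (c : K) x y, bmul (c *: x) y = c *: bmul x y;
  bmulZr : forall (c : K) x y, bmul x (c *: y) = c *: bmul x y;
  normr_bmul_le : forall x y, `|bmul x y| <= `|x| * `|y| }.

#[short(type="banachAlgType")]
HB.structure Definition BanachAlgebra (K : numFieldType) :=
  { A of CompleteNormedModule K A & CompleteNormedModule_isBanachAlgebra K A }.

Section Amenability.
Context {R : realType} (A : banachAlgType R[i]).

Lemma nrm_bmul_le (x y : A) : nrm (bmul x y) <= nrm x * nrm y.
Proof. by rewrite -lecR rmorphM/= -!nrmE normr_bmul_le. Qed.

Lemma bmul_bilinear : bilinear_map (bmul : A -> A -> A).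
Proof.
by split=> [y c x x'|x c y y']; rewrite ?bmulDl ?bmulDr ?bmulZl ?bmulZr.
Qed.

Lemma bmul_bounded_bilinear : bounded_bilinear (bmul : A -> A -> A).
Proof.
split; first exact: bmul_bilinear.
by exists 1 => x y; rewrite mul1r nrm_bmul_le.
Qed.

Lemma lmul_bounded (a : A) : bounded_op (bmul a).
Proof.
split; first by move=> c x y; rewrite bmulDr bmulZr.
by exists (nrm a) => x; exact: nrm_bmul_le.
Qed.

Lemma rmul_bounded (a : A) : bounded_op (bmul^~ a : A -> A).
Proof.
split; first by move=> c x y; rewrite bmulDl bmulZl.
by exists (nrm a) => x; rewrite mulrC; exact: nrm_bmul_le.
Qed.

Lemma lact_bounded (a : A) :
  bounded_bilinear (fun x y : A => tens (bmul a x) y : ptens A A).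
Proof.
have [tl tr] := tens_bilinear A A; split.
  by split=> [y c x x'|x c y y']; rewrite ?bmulDr ?bmulZr; [exact: tl|exact: tr].
exists (nrm a) => x y; apply: le_trans (nrm_tens_le _ _) _.
by rewrite mulrA ler_wpM2r ?nrm_ge0 ?nrm_bmul_le.
Qed.

Lemma ract_bounded (a : A) :
  bounded_bilinear (fun x y : A => tens x (bmul y a) : ptens A A).
Proof.
have [tl tr] := tens_bilinear A A; split.
  by split=> [y c x x'|x c y y']; rewrite ?bmulDl ?bmulZl; [exact: tl|exact: tr].
exists (nrm a) => x y; apply: le_trans (nrm_tens_le _ _) _.
by rewrite mulrCA ler_wpM2l ?nrm_ge0// mulrC nrm_bmul_le.
Qed.

Definition lmul (a : A) : bop A A := mkBop (lmul_bounded a).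
Definition rmul (a : A) : bop A A := mkBop (rmul_bounded a).

(** [a . (x (x) y) = (a x) (x) y] and [(x (x) y) . a = x (x) (y a)] *)
Definition lact (a : A) : bop (ptens A A) (ptens A A) := ptens_lift (lact_bounded a).
Definition ract (a : A) : bop (ptens A A) (ptens A A) := ptens_lift (ract_bounded a).

Definition prod_map : bop (ptens A A) A := ptens_lift bmul_bounded_bilinear.

(** The bimodule actions on a bidual are the biadjoints of the actions on the
    underlying space. *)
Definition virtual_diagonal (M : dual_space (dual_space (ptens A A))) : Prop :=
  forall a : A,
    [/\ biadjoint (lact a) M = biadjoint (ract a) M,
        biadjoint (lmul a) (biadjoint prod_map M) = bidual_eval a &
        biadjoint (rmul a) (biadjoint prod_map M) = bidual_eval a].

Definition amenable : Prop := exists M, virtual_diagonal M.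

(** The infimum of the empty set is [+oo], the value for non-amenable algebras. *)
Definition AM : \bar R := ereal_inf [set (nrm M)%:E | M in virtual_diagonal].

End Amenability.

(** A Banach sequence lattice on [I]: a Banach space [E] together with the
    injective linear map that reads its elements as functions on [I]. *)
Record bseqLattice (R : realType) (I : Type) := BSeqLattice {
  bsl_space :> completeNormedModType R[i];
  bsl_fun : {linear bsl_space -> (I -> R[i]^o)};
  bsl_inj : injective bsl_fun;
  bsl_c00 : forall x : I -> R[i]^o, finite_set [set i | x i != 0] ->
    exists e, bsl_fun e = x;
  bsl_linfty : forall e, exists c, forall i, `|bsl_fun e i| <= c;
  bsl_dense : dense [set e : bsl_space | finite_set [set i | bsl_fun e i != 0]];
  bsl_solid : forall (y : bsl_space) (x : I -> R[i]^o),
    (exists c, forall i, `|x i| <= c) ->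
    (forall i, `|x i| <= `|bsl_fun y i|) ->
    exists2 e, bsl_fun e = x & `|e| <= `|y|;
  bsl_sup_le : forall e i, `|bsl_fun e i| <= `|e| }.

Arguments bsl_fun {R I b}.

Section BSeqLatticeTheory.
Context {R : realType} {I : Type} (E : bseqLattice R I).

Lemma bsl_funD (e f : E) i : bsl_fun (e + f) i = bsl_fun e i + bsl_fun f i :> R[i].
Proof. by rewrite raddfD. Qed.

Lemma bsl_funZ c (e : E) i : bsl_fun (c *: e) i = c * bsl_fun e i :> R[i].
Proof. by rewrite linearZ. Qed.

Lemma bsl_funB (e f : E) i : bsl_fun (e - f) i = bsl_fun e i - bsl_fun f i :> R[i].
Proof. by rewrite raddfB. Qed.

Definition bsl_mem (x : I -> R[i]^o) : Prop := exists e : E, bsl_fun e = x.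

(** [|x|_E]; junk value 0 when [x] is not in [E] *)
Definition bsl_norm (x : I -> R[i]^o) : R :=
  nrm (xget (0 : E) [set e | bsl_fun e = x]).

Lemma bsl_normE (e : E) : bsl_norm (bsl_fun e) = nrm e.
Proof.
rewrite /bsl_norm; case: xgetP => [e' _ /bsl_inj -> //|/(_ e)].
by case.
Qed.

Lemma bsl_solidP (y : E) (x : I -> R[i]^o) :
  (forall i, nrm (x i : R[i]) <= nrm (bsl_fun y i : R[i])) ->
  bsl_mem x /\ bsl_norm x <= nrm y.
Proof.
move=> h; have h' i : `|x i| <= `|bsl_fun y i|.
  by rewrite [leLHS]nrmE [leRHS]nrmE lecR; exact: h.
have [|e ex ey] := bsl_solid (y := y) (x := x) _ h'.
  have [c hc] := bsl_linfty y; exists c => i; exact: le_trans (h' i) (hc i).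
split; first by exists e.
by rewrite -ex bsl_normE -lecR -!nrmE.
Qed.

End BSeqLatticeTheory.

Definition char_const {R : realType} {I : Type} (E : bseqLattice R I) : \bar R :=
  ereal_sup [set (bsl_norm E (\1_F : I -> R[i]))%:E | F in [set F | finite_set F]].

Section ESum.
Context {R : realType} {I : Type} (E : bseqLattice R I)
  (A : I -> banachAlgType R[i]).

Definition nseq_of (a : forall i, A i) : I -> R[i]^o := fun i => `|a i|.

Record Esum := mkEsum {
  Esum_fun :> forall i, A i;
  EsumP : bsl_mem E (nseq_of Esum_fun) }.

HB.instance Definition _ := gen_eqMixin Esum.
HB.instance Definition _ := gen_choiceMixin Esum.

Lemma Esum_eq (a b : Esum) : (forall i, a i = b i) -> a = b.
Proof.
case: a b => [a ha] [b hb] /= h.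
have ab : a = b by apply: functional_extensionality_dep.
by rewrite ab in ha *; congr mkEsum; exact: Prop_irrelevance.
Qed.

Definition Esum_norm (a : Esum) : R := bsl_norm E (nseq_of a).

Lemma nseq_ofC (a : forall i, A i) i : nseq_of a i = (nrm (a i))%:C.
Proof. exact: nrmE. Qed.

Lemma nseq_ofE (a : forall i, A i) i : nrm (nseq_of a i : R[i]) = nrm (a i).
Proof. by rewrite /nseq_of nrmE nrm_real ger0_norm ?nrm_ge0. Qed.

Lemma Esum_rep (a : Esum) :
  exists2 e : E, bsl_fun e = nseq_of a & Esum_norm a = nrm e.
Proof. by have [e he] := EsumP a; exists e => //; rewrite /Esum_norm -he bsl_normE. Qed.

Lemma Esum_solid (a : forall i, A i) (e : E) :
  (forall i, nrm (a i) <= nrm (bsl_fun e i : R[i])) ->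
  bsl_mem E (nseq_of a) /\ bsl_norm E (nseq_of a) <= nrm e.
Proof. by move=> h; apply: bsl_solidP => i; rewrite nseq_ofE. Qed.

Lemma Esum0_subproof : bsl_mem E (nseq_of (fun i => 0)).
Proof. by apply: (Esum_solid (e := 0) _).1 => i; rewrite nrm0 nrm_ge0. Qed.

Lemma EsumD_le (a b : Esum) :
  bsl_mem E (nseq_of (fun i => a i + b i)) /\
  bsl_norm E (nseq_of (fun i => a i + b i)) <= Esum_norm a + Esum_norm b.
Proof.
have [e ea ->] := Esum_rep a; have [f fb ->] := Esum_rep b.
have [i|h1 h2] := @Esum_solid (fun i => a i + b i) (e + f).
  have -> : bsl_fun (e + f) i = (nrm (a i) + nrm (b i))%:C :> R[i].
    rewrite rmorphD/= -!nseq_ofC -ea -fb.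
    exact: bsl_funD.
  by rewrite nrm_real (le_trans (ler_nrmD _ _) (ler_norm _)).
by split=> //; apply: le_trans h2 (ler_nrmD _ _).
Qed.

Lemma EsumZ_le (c : R[i]) (a : Esum) :
  bsl_mem E (nseq_of (fun i => c *: a i)) /\
  bsl_norm E (nseq_of (fun i => c *: a i)) <= nrm c * Esum_norm a.
Proof.
have [e ea ->] := Esum_rep a; rewrite -nrmZ; apply: Esum_solid => i.
have -> : bsl_fun (c *: e) i = c * nseq_of a i :> R[i].
  by rewrite -ea; exact: bsl_funZ.
by rewrite nrmM nseq_ofE nrmZ.
Qed.

Definition Esum_zero : Esum := mkEsum Esum0_subproof.
Definition Esum_add (a b : Esum) : Esum := mkEsum (EsumD_le a b).1.
Definition Esum_scale (c : R[i]) (a : Esum) : Esum := mkEsum (EsumZ_le c a).1.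
Definition Esum_opp (a : Esum) : Esum := Esum_scale (-1) a.

Lemma Esum_addA : associative Esum_add.
Proof. by move=> a b c; apply: Esum_eq => i /=; rewrite addrA. Qed.
Lemma Esum_addC : commutative Esum_add.
Proof. by move=> a b; apply: Esum_eq => i /=; rewrite addrC. Qed.
Lemma Esum_add0 : left_id Esum_zero Esum_add.
Proof. by move=> a; apply: Esum_eq => i /=; rewrite add0r. Qed.
Lemma Esum_addN : left_inverse Esum_zero Esum_opp Esum_add.
Proof. by move=> a; apply: Esum_eq => i /=; rewrite scaleN1r addNr. Qed.

HB.instance Definition _ :=
  GRing.isZmodule.Build Esum Esum_addA Esum_addC Esum_add0 Esum_addN.

Lemma Esum_scaleA c d a : Esum_scale c (Esum_scale d a) = Esum_scale (c * d) a.
Proof. by apply: Esum_eq => i /=; rewrite scalerA. Qed.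
Lemma Esum_scale1 : left_id 1 Esum_scale.
Proof. by move=> a; apply: Esum_eq => i /=; rewrite scale1r. Qed.
Lemma Esum_scaleDr : right_distributive Esum_scale +%R.
Proof. by move=> c a b; apply: Esum_eq => i /=; rewrite scalerDr. Qed.
Lemma Esum_scaleDl a : {morph Esum_scale^~ a : c d / c + d}.
Proof. by move=> c d; apply: Esum_eq => i /=; rewrite scalerDl. Qed.

HB.instance Definition _ := GRing.Zmodule_isLmodule.Build R[i] Esum
  Esum_scaleA Esum_scale1 Esum_scaleDr Esum_scaleDl.

Lemma EsumDE (a b : Esum) i : (a + b) i = a i + b i. Proof. by []. Qed.
Lemma EsumZE (c : R[i]) (a : Esum) i : (c *: a) i = c *: a i. Proof. by []. Qed.
Lemma EsumBE (a b : Esum) i : (a - b) i = a i - b i.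
Proof. by rewrite EsumDE -[(- b) i]/(-1 *: b i) scaleN1r. Qed.

Lemma Esum_norm_ge0 a : 0 <= Esum_norm a.
Proof. exact: nrm_ge0. Qed.

Lemma le_Esum_norm (a : Esum) i : nrm (a i) <= Esum_norm a.
Proof.
have [e ea ->] := Esum_rep a; rewrite -nseq_ofE -ea -lecR -!nrmE.
exact: bsl_sup_le.
Qed.

Let Esum_normD (a b : Esum) : Esum_norm (a + b) <= Esum_norm a + Esum_norm b.
Proof. exact: (EsumD_le a b).2. Qed.

Let Esum_normZ (c : R[i]) a : Esum_norm (c *: a) = nrm c * Esum_norm a.
Proof. exact: (subhomogeneous Esum_norm_ge0 (fun c a => (EsumZ_le c a).2)). Qed.

Let cnorm (a : Esum) : R[i] := (Esum_norm a)%:C.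
Let cnormD a b : cnorm (a + b) <= cnorm a + cnorm b.
Proof. by rewrite /cnorm -raddfD lecR Esum_normD. Qed.
Let cnormZ c a : cnorm (c *: a) = `|c| * cnorm a.
Proof. by rewrite /cnorm Esum_normZ rmorphM/= -nrmE. Qed.
Let cnorm_eq0 a : cnorm a = 0 -> a = 0.
Proof.
move/(@complexI R) => h; apply: Esum_eq => i; apply/nrm0_eq0/eqP.
by rewrite eq_le nrm_ge0 andbT -h le_Esum_norm.
Qed.

HB.instance Definition _ :=
  Lmodule_isNormed.Build R[i] Esum cnormD cnormZ cnorm_eq0.

Lemma nrm_Esum (a : Esum) : nrm a = bsl_norm E (nseq_of a).
Proof. by []. Qed.

(* The coordinatewise limit of a Cauchy sequence [U] is reached through the
   moduli [|U_n - b|], which form a Cauchy sequence in [E]. *)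
Lemma Esum_cauchy_dist (U : nat -> Esum) (l : forall i, A i) (b : Esum) :
  cauchyn nrm U -> (forall i, ncvg (fun n => U n i) (l i)) ->
  exists2 c : Esum, (forall i, c i = l i - b i) &
    (fun n => nrm (U n - b)) @ \oo --> nrm c.
Proof.
move=> cU Ul.
have [e he] := choice (fun n => EsumP (U n - b)).
have ce : cauchyn nrm e.
  move=> d /cU[N hN]; exists N => m n Nm Nn; apply: le_lt_trans (hN m n Nm Nn).
  have [f hf nf] := Esum_rep (U m - U n).
  rewrite [leRHS](nf : nrm (U m - U n) = _).
  rewrite -bsl_normE; apply: (@bsl_solidP _ _ E f _ _).2 => i.
  have -> : bsl_fun (e m - e n) i = (nrm ((U m - b) i) - nrm ((U n - b) i))%:C :> R[i].
    by rewrite bsl_funB !he !nseq_ofC -(rmorphB (real_complex R)).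
  rewrite hf nseq_ofE nrm_real.
  apply: le_trans (ler_nrm_dist _ _) _.
  by rewrite !EsumBE opprB addrA subrK.
have [f ef] := complete_seq ce.
have fE : bsl_fun f = nseq_of (fun i => l i - b i).
  apply/funext => i.
  have h1 : ncvg (fun n => bsl_fun (e n) i) (bsl_fun f i).
    apply: squeeze0 ef => n; rewrite nrm_ge0/=.
    have := bsl_sup_le (e n - f) i; rewrite !nrmE lecR; apply: le_trans.
    by rewrite bsl_funB.
  have h2 : ncvg (fun n => bsl_fun (e n) i) (nseq_of (fun i => l i - b i) i).
    apply: squeeze0 (Ul i) => n; rewrite nrm_ge0/= he !nseq_ofC.
    rewrite -(rmorphB (real_complex R)) [leLHS]nrm_real.
    apply: le_trans (ler_nrm_dist _ _) _.
    by rewrite EsumBE opprB addrA subrK.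
  exact: ncvg_uniq h1 h2.
exists (mkEsum (ex_intro _ f fE)) => //.
rewrite nrm_Esum/= -fE bsl_normE.
rewrite (_ : (fun n => _) = fun n => nrm (e n)); first exact: ncvg_nrm.
by apply/funext => n; rewrite nrm_Esum -he bsl_normE.
Qed.

Lemma Esum_seq_complete (U : nat -> Esum) : cauchyn nrm U ->
  exists l, (fun n => nrm (U n - l)) @ \oo --> (0 : R).
Proof.
move=> cU.
have hl i : exists l, ncvg (fun n => U n i) l.
  apply: complete_seq => e /cU[N hN]; exists N => m n Nm Nn.
  by apply: le_lt_trans (hN m n Nm Nn); rewrite -EsumBE; exact: le_Esum_norm.
pose l i := sval (cid (hl i)).
have lP i : ncvg (fun n => U n i) (l i) by exact: svalP (cid (hl i)).
have [a ha _] := Esum_cauchy_dist 0 cU lP.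
exists a; apply/cvg0P => [n|e e0]; first exact: nrm_ge0.
have [|N hN] := cU (e / 2); first by rewrite divr_gt0.
exists N => n Nn; rewrite (@le_lt_trans _ _ (e / 2))//; last first.
  by rewrite ltr_pdivrMr// ltr_pMr// ltr1n.
have [c hc Uc] := Esum_cauchy_dist (U n) cU lP.
have -> : nrm (U n - a) = nrm c.
  rewrite nrmB; congr nrm; apply: Esum_eq => i; rewrite EsumBE ha hc.
  by congr (_ - _); rewrite -[RHS]subr0.
apply: le_cvg Uc (cvg_cst (e / 2)) _.
by exists N => m Nm; apply/ltW/hN.
Qed.

HB.instance Definition _ := Uniform_isComplete.Build Esum
  (seq_complete Esum_seq_complete).

Lemma EsumM_le (a b : Esum) :
  bsl_mem E (nseq_of (fun i => bmul (a i) (b i))) /\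
  bsl_norm E (nseq_of (fun i => bmul (a i) (b i))) <= Esum_norm a * Esum_norm b.
Proof.
have [e eb ->] := Esum_rep b.
have -> : Esum_norm a * nrm e = nrm ((Esum_norm a)%:C *: e).
  by rewrite nrmZ nrm_real ger0_norm// Esum_norm_ge0.
apply: Esum_solid => i.
have -> : bsl_fun ((Esum_norm a)%:C *: e) i = (Esum_norm a)%:C * nseq_of b i :> R[i].
  by rewrite -eb; exact: bsl_funZ.
rewrite nrmM nseq_ofE nrm_real ger0_norm ?Esum_norm_ge0//.
apply: le_trans (nrm_bmul_le _ _) _.
by rewrite ler_wpM2r ?nrm_ge0// le_Esum_norm.
Qed.

Definition Esum_mul (a b : Esum) : Esum := mkEsum (EsumM_le a b).1.

Let Esum_mulA : associative Esum_mul.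
Proof. by move=> a b c; apply: Esum_eq => i /=; rewrite bmulA. Qed.
Let Esum_mulDl : left_distributive Esum_mul +%R.
Proof. by move=> a b c; apply: Esum_eq => i /=; rewrite bmulDl. Qed.
Let Esum_mulDr : right_distributive Esum_mul +%R.
Proof. by move=> a b c; apply: Esum_eq => i /=; rewrite bmulDr. Qed.
Let Esum_mulZl (c : R[i]) a b : Esum_mul (c *: a) b = c *: Esum_mul a b.
Proof. by apply: Esum_eq => i /=; rewrite bmulZl. Qed.
Let Esum_mulZr (c : R[i]) a b : Esum_mul a (c *: b) = c *: Esum_mul a b.
Proof. by apply: Esum_eq => i /=; rewrite bmulZr. Qed.
Let Esum_mul_le a b : `|Esum_mul a b| <= `|a| * `|b|.
Proof. by rewrite !nrmE -rmorphM/= lecR; exact: (EsumM_le a b).2. Qed.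

HB.instance Definition _ := CompleteNormedModule_isBanachAlgebra.Build R[i] Esum
  Esum_mulA Esum_mulDl Esum_mulDr Esum_mulZl Esum_mulZr Esum_mul_le.

End ESum.

(* Main.v *)
(** The upper bound needs no limit of approximate diagonals: a virtual diagonal
    of the [E]-sum is the unconditional sum
      [M phi = \sum_i M_i (phi_i)],
    where [M_i] is a virtual diagonal of [A_i] and [phi_i] is the restriction of
    the bilinear form [phi] to [A_i x A_i]. It converges because
      [\sum_i |phi_i| <= C_E^2 |phi|]:
    if [x_i], [y_i] are unit vectors almost norming [phi_i], averaging over signs
    the values [phi (\sum_i +-x_i, \sum_i +-y_i)] leaves [\sum_i phi (x_i, y_i)],
    and both arguments have norm at most [C_E]. The lower bound holds because each
    coordinate is a contractive homomorphism onto [A_i]. *)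

Require Import Defs.
From mathcomp Require Import all_boot all_order all_algebra.
From mathcomp Require Import all_classical all_reals all_analysis.
From mathcomp Require Import complex finmap lra.
Set Implicit Arguments.
Unset Strict Implicit.
Unset Printing Implicit Defensive.
Import Order.TTheory GRing.Theory Num.Theory.
Import numFieldNormedType.Exports.
Local Open Scope classical_set_scope.
Local Open Scope ring_scope.
Local Open Scope complex_scope.

(** * Unconditional sums over an arbitrary index set *)

Section Sums.
Context {R : realType} {I : choiceType}.

Lemma fsumr_le (f : I -> R) (F G : {fset I}) : (forall i, 0 <= f i) ->
  (F `<=` G)%fset -> \sum_(i <- F) f i <= \sum_(i <- G) f i.
Proof.
move=> f0 FG; rewrite [leRHS](big_fsetID _ (mem F))/=.
have -> : [fset x | x in G & x \in F]%fset = F.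
  apply/fsetP => x; rewrite !inE; apply/andP/idP => [[]//|xF].
  by split=> //; exact: (fsubsetP FG).
by rewrite lerDl sumr_ge0.
Qed.

(** Unconditional convergence: the limit along finite subsets directed by inclusion, since [I] has
    no order and may be uncountable. *)
Definition has_fsum {V : normedModType R[i]} (f : I -> V) (l : V) : Prop :=
  forall e : R, 0 < e -> exists F0 : {fset I}, forall F : {fset I},
    (F0 `<=` F)%fset -> nrm (\sum_(i <- F) f i - l) < e.

Section Theory.
Context {V W : normedModType R[i]}.
Implicit Types (f g : I -> V) (l m : V).

Lemma has_fsum_le f l (c : R) : has_fsum f l ->
  (forall F : {fset I}, nrm (\sum_(i <- F) f i) <= c) -> nrm l <= c.
Proof.
move=> fl fc; apply/ler_addgt0Pr => e /fl[F /(_ _ (fsubset_refl F))/ltW h].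
rewrite -[l](subKr (\sum_(i <- F) f i)); apply: le_trans (ler_nrmD _ _) _.
by rewrite nrmN lerD.
Qed.

Lemma has_fsum_lin f g l m (c : R[i]) : has_fsum f l -> has_fsum g m ->
  has_fsum (fun i => c *: f i + g i) (c *: l + m).
Proof.
move=> fl gm e e0; have c1 : 0 < nrm c + 1 by rewrite ltr_wpDl ?nrm_ge0.
have [|F hF] := fl (e / 2 / (nrm c + 1)); first by rewrite !divr_gt0.
have [|G hG] := gm (e / 2); first by rewrite divr_gt0.
exists (F `|` G)%fset => H; rewrite fsubUset => /andP[/hF {}hF /hG {}hG].
rewrite big_split/= -scaler_sumr opprD addrACA -scalerBr.
apply: le_lt_trans (ler_nrmD _ _) _; rewrite [ltRHS](splitr e) ler_ltD// nrmZ.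
rewrite ltr_pdivlMr// in hF; apply: le_trans (ltW hF).
by rewrite mulrC ler_wpM2l ?nrm_ge0// lerDl.
Qed.

Lemma has_fsum_uniq f l m : has_fsum f l -> has_fsum f m -> l = m.
Proof.
move=> fl fm; apply/subr0_eq/nrm0_eq0/eqP; rewrite eq_le nrm_ge0 andbT.
have := has_fsum_lin (-1) fm fl; rewrite scaleN1r addrC => /has_fsum_le; apply.
by move=> F; rewrite big1 ?nrm0// => i _; rewrite scaleN1r addNr.
Qed.

Lemma has_fsum_bop f l (T : bop V W) : has_fsum f l -> has_fsum (T \o f) (T l).
Proof.
move=> fl e e0; have c1 : 0 < opnorm T + 1 by rewrite ltr_wpDl ?opnorm_ge0.
have [|F hF] := fl (e / (opnorm T + 1)); first by rewrite divr_gt0.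
exists F => G /hF; rewrite ltr_pdivlMr// => h; rewrite -raddf_sum -raddfB.
apply: le_lt_trans (le_opnorm _ _) (le_lt_trans _ h).
by rewrite mulrC ler_wpM2l ?nrm_ge0// lerDl.
Qed.

End Theory.

(** Partial sums of nonnegative terms increase with the finite set, so their supremum is the
    limit. *)
Lemma has_fsum_ge0 (f : I -> R) (c : R) : (forall i, 0 <= f i) ->
  (forall F : {fset I}, \sum_(i <- F) f i <= c) ->
  exists l, has_fsum (fun i => (f i)%:C : R[i]^o) l.
Proof.
move=> f0 fc; pose S := [set \sum_(i <- F) f i | F in [set: {fset I}]].
have hS : has_sup S.
  split; first by exists 0, fset0 => //; rewrite big_seq_fset0.
  by exists c => _ [F _ <-].
exists (sup S)%:C => e e0; have [_ [F _ <-] hF] := sup_adherent e0 hS.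
exists F => G FG; rewrite -(raddf_sum (real_complex R)) -(rmorphB (real_complex R)).
rewrite [nrm _]nrm_real distrC ger0_norm ?subr_ge0; last first.
  by apply: ub_le_sup; [case: hS|exists G].
by rewrite ltrBlDl -ltrBlDr (lt_le_trans hF)// fsumr_le.
Qed.

(** Reduces to nonnegative terms: split [f] into real and imaginary parts, and each of these into
    positive and negative parts, all dominated by [nrm (f i)]. *)
Lemma abs_summable (f : I -> R[i]^o) (c : R) :
  (forall F : {fset I}, \sum_(i <- F) nrm (f i) <= c) -> exists l, has_fsum f l.
Proof.
move=> fc.
have pos (h : I -> R) : (forall i, 0 <= h i <= nrm (f i)) ->
    exists l, has_fsum (fun i => (h i)%:C : R[i]^o) l.
  move=> hf; apply: (@has_fsum_ge0 _ c) => [i|F]; first by case/andP: (hf i).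
  by apply: le_trans (fc F); apply: ler_sum => i _; case/andP: (hf i).
have rl (h : I -> R) : (forall i, `|h i| <= nrm (f i)) ->
    exists l, has_fsum (fun i => (h i)%:C : R[i]^o) l.
  move=> hf; have [|p hp] := pos (fun i => Num.max (h i) 0).
    move=> i; rewrite le_max lexx orbT ge_max nrm_ge0 andbT/=.
    exact: le_trans (ler_norm _) (hf i).
  have [|n hn] := pos (fun i => Num.max (- h i) 0).
    move=> i; rewrite le_max lexx orbT ge_max nrm_ge0 andbT/=.
    by apply: le_trans (ler_norm _) _; rewrite normrN.
  exists (-1 *: n + p); have := has_fsum_lin (-1) hn hp.
  congr has_fsum; apply/funext => i; rewrite scaleN1r addrC -rmorphB/=.
  by congr _%:C; case: (leP (h i) 0) => h0; case: (leP (- h i) 0) => h1; lra.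
have [|r hr] := rl (fun i => complex.Re (f i)).
  by move=> i; rewrite -lecR -nrmE; exact: normc_ge_Re.
have [|s hs] := rl (fun i => complex.Im (f i)).
  move=> i; rewrite /nrm normc_def/= -sqrtr_sqr ler_sqrt ?addr_ge0 ?sqr_ge0//.
  by rewrite lerDr sqr_ge0.
exists ('i *: s + r); have := has_fsum_lin 'i hs hr.
congr has_fsum; apply/funext => i; case: (f i) => a b; simpc.
by rewrite /GRing.scale/=; simpc.
Qed.

End Sums.

(** * Tensor products of operators, and virtual diagonals under homomorphisms *)

Section TensorMaps.
Context {R : realType}.

Section PtensMap.
Context {V V' W W' : normedModType R[i]} (S : bop V V') (T : bop W W').

Lemma ptens_map_le v w : nrm (tens (S v) (T w)) <= nrm S * nrm T * (nrm v * nrm w).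
Proof.
apply: le_trans (nrm_tens_le _ _) _; rewrite mulrACA.
by rewrite ler_pM ?nrm_ge0//; exact: le_opnorm.
Qed.

Lemma ptens_map_bounded :
  bounded_bilinear (fun v w => tens (S v) (T w) : ptens V' W').
Proof.
have [tl tr] := tens_bilinear V' W'; split; last first.
  by exists (nrm S * nrm T); exact: ptens_map_le.
by split=> [w c x y|v c x y]; rewrite linearP; [exact: tl|exact: tr].
Qed.

Definition ptens_map : bop (ptens V W) (ptens V' W') := ptens_lift ptens_map_bounded.

Lemma ptens_mapE v w : ptens_map (tens v w) = tens (S v) (T w).
Proof. exact: ptens_liftE. Qed.

Lemma nrm_ptens_map : nrm ptens_map <= nrm S * nrm T.
Proof. by apply: nrm_ptens_lift; rewrite ?mulr_ge0 ?nrm_ge0//; exact: ptens_map_le. Qed.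

End PtensMap.

(** Phrased for commuting squares because that is how the module actions and the product map are
    intertwined with a homomorphism. *)
Lemma adjoint_square (U V V' W : normedModType R[i]) (S : bop V W) (T : bop U V)
    (S' : bop V' W) (T' : bop U V') f : bop_comp S T = bop_comp S' T' ->
  adjoint T (adjoint S f) = adjoint T' (adjoint S' f).
Proof.
move=> e; apply: bopP => x.
by congr (bop_fun f _); exact: (congr1 (fun g : bop U W => g x) e).
Qed.

Lemma biadjoint_square (U V V' W : normedModType R[i]) (S : bop V W) (T : bop U V)
    (S' : bop V' W) (T' : bop U V') M : bop_comp S T = bop_comp S' T' ->
  biadjoint S (biadjoint T M) = biadjoint S' (biadjoint T' M).
Proof. by move=> e; apply: bopP => f; congr (bop_fun M _); exact: adjoint_square. Qed.

Lemma biadjoint_eval (V W : normedModType R[i]) (T : bop V W) x :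
  biadjoint T (bidual_eval x) = bidual_eval (T x).
Proof. exact: bopP. Qed.

Lemma nrm_biadjoint (V W : normedModType R[i]) (T : bop V W) M :
  nrm (biadjoint T M) <= nrm T * nrm M.
Proof.
rewrite -[leLHS]/(opnorm _).
apply: opnorm_le => [|f]; first by rewrite mulr_ge0 ?nrm_ge0.
apply: le_trans (le_opnorm M _) _; rewrite -mulrA mulrCA ler_wpM2l ?opnorm_ge0//.
rewrite -[leLHS]/(opnorm _).
apply: opnorm_le => [|x]; first by rewrite mulr_ge0 ?nrm_ge0.
apply: le_trans (le_opnorm f (T x)) _.
by rewrite (mulrC (nrm T)) -mulrA ler_wpM2l ?opnorm_ge0//; exact: le_opnorm.
Qed.

Section Actions.
Context {A : banachAlgType R[i]} (a x y : A).

Lemma lactE : lact a (tens x y) = tens (bmul a x) y.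
Proof. exact: (ptens_liftE (lact_bounded a)). Qed.

Lemma ractE : ract a (tens x y) = tens x (bmul y a).
Proof. exact: (ptens_liftE (ract_bounded a)). Qed.

Lemma prod_mapE : prod_map A (tens x y) = bmul x y.
Proof. exact: (ptens_liftE (bmul_bounded_bilinear A)). Qed.

End Actions.

Section Morphism.
Context {A B : banachAlgType R[i]} (h : bop A B).

(* Chained with [etrans] and [congr1]: rewriting under these operators makes
   unification unfold the completion. *)
Lemma lact_ptens_map (a : A) (b : B) : (forall x, bmul b (h x) = h (bmul a x)) ->
  bop_comp (lact b) (ptens_map h h) = bop_comp (ptens_map h h) (lact a).
Proof.
move=> ab; apply: ptens_ext => x y.
apply: (etrans (congr1 (lact b) (ptens_mapE h h x y))).
apply: (etrans (lactE b (h x) (h y))).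
apply/esym/(etrans (congr1 (ptens_map h h) (lactE a x y))).
by apply: (etrans (ptens_mapE h h _ _)); rewrite -ab.
Qed.

Lemma ract_ptens_map (a : A) (b : B) : (forall x, bmul (h x) b = h (bmul x a)) ->
  bop_comp (ract b) (ptens_map h h) = bop_comp (ptens_map h h) (ract a).
Proof.
move=> ab; apply: ptens_ext => x y.
apply: (etrans (congr1 (ract b) (ptens_mapE h h x y))).
apply: (etrans (ractE b (h x) (h y))).
apply/esym/(etrans (congr1 (ptens_map h h) (ractE a x y))).
by apply: (etrans (ptens_mapE h h _ _)); rewrite -ab.
Qed.

Hypothesis hM : forall x y, h (bmul x y) = bmul (h x) (h y).

Lemma prod_ptens_map :
  bop_comp (prod_map B) (ptens_map h h) = bop_comp h (prod_map A).
Proof.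
apply: ptens_ext => x y.
apply: (etrans (congr1 (prod_map B) (ptens_mapE h h x y))).
apply: (etrans (prod_mapE (h x) (h y))).
by apply/esym/(etrans (congr1 h (prod_mapE x y))).
Qed.

Lemma lmul_morph a : bop_comp (lmul (h a)) h = bop_comp h (lmul a).
Proof. by apply: bopP => x; rewrite /= hM. Qed.

Lemma rmul_morph a : bop_comp (rmul (h a)) h = bop_comp h (rmul a).
Proof. by apply: bopP => x; rewrite /= hM. Qed.

Hypothesis h_surj : forall b, exists a, h a = b.

(** The tensor square of [h] intertwines the actions of [a] and [h a] as well as the two product
    maps, and by surjectivity every element of [B] is some [h a]. *)
Lemma virtual_diagonal_image M : virtual_diagonal M ->
  virtual_diagonal (biadjoint (ptens_map h h) M).
Proof.
move=> Md b; have [a <-] := h_surj b; have [M1 M2 M3] := Md a.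
have prodE := biadjoint_square M prod_ptens_map; split.
- apply: (etrans (biadjoint_square M (lact_ptens_map (a := a) _))) => [x|].
    by rewrite hM.
  apply: (etrans (congr1 (biadjoint (ptens_map h h)) M1)); apply/esym.
  by apply: (biadjoint_square M (ract_ptens_map (a := a) _)) => x; rewrite hM.
- apply: (etrans (congr1 (biadjoint (lmul (h a))) prodE)).
  apply: (etrans (biadjoint_square _ (lmul_morph a))).
  by apply: (etrans (congr1 (biadjoint h) M2)); exact: biadjoint_eval.
- apply: (etrans (congr1 (biadjoint (rmul (h a))) prodE)).
  apply: (etrans (biadjoint_square _ (rmul_morph a))).
  by apply: (etrans (congr1 (biadjoint h) M3)); exact: biadjoint_eval.
Qed.

(** The tensor square of a contraction is a contraction, so the image of a virtual diagonal has no
    larger norm. If [A] has none, [AM A] is [+oo]. *)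
Lemma AM_image : nrm h <= 1 -> (AM B <= AM A)%E.
Proof.
move=> h1; apply: le_ereal_inf_tmp => _ [M Md <-]; apply: ge_ereal_inf.
exists (nrm (biadjoint (ptens_map h h) M))%:E.
  by exists (biadjoint (ptens_map h h) M) => //; exact: virtual_diagonal_image.
rewrite lee_fin; apply: le_trans (nrm_biadjoint _ _) _.
rewrite -[leRHS]mul1r ler_wpM2r ?nrm_ge0//; apply: le_trans (nrm_ptens_map _ _) _.
by rewrite -[leRHS]mulr1 ler_pM ?nrm_ge0.
Qed.

End Morphism.
End TensorMaps.

(** * Norms of functionals on projective tensor products *)

Section BilinearForms.
Context {R : realType}.

Lemma nrm_gt0 (V : normedModType R[i]) (x : V) : x != 0 -> 0 < nrm x.
Proof. by move=> x0; rewrite lt0r nrm_ge0 andbT; apply: contraNneq x0 => /nrm0_eq0 ->. Qed.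

Lemma dual_linear (V : normedModType R[i]) (f : dual_space V) (c : R[i]) x y :
  f (c *: x + y) = c * f x + f y :> R[i].
Proof. by rewrite linearP. Qed.

Lemma adjointE (V W : normedModType R[i]) (T : bop V W) (f : dual_space W) x :
  adjoint T f x = f (T x).
Proof. by []. Qed.

(* [G] need not be complete, so [T] is first composed with the embedding of [G]
   into its completion, where the universal property applies. *)
Lemma nrm_ptens_le (V W G : normedModType R[i]) (T : bop (ptens V W) G) (c : R) :
  0 <= c -> (forall v w, nrm (T (tens v w)) <= c * (nrm v * nrm w)) -> nrm T <= c.
Proof.
move=> c0 hc; pose p : seminorm G := Seminorm (@ler_nrmD R G) (@nrmZ R G).
have Jlin : linear (inj_completion p) by exact: inj_completion_linear.
have Jb : bounded_op (inj_completion p).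
  split=> //.
  by exists 1 => x; rewrite nrm_inj_completion mul1r.
pose J := mkBop Jb; have nJ x : nrm (J x) = nrm x by exact: nrm_inj_completion.
pose phi v w := J (T (tens v w)).
have hphi v w : nrm (phi v w) <= c * (nrm v * nrm w) by rewrite /phi nJ.
have bphi : bounded_bilinear phi.
  split; last by exists c.
  have [tl tr] := tens_bilinear V W.
  split=> [w a x y|v a x y]; rewrite /phi.
    by apply: etrans (Jlin _ _ _); rewrite -linearP -(tl w a x y).
  by apply: etrans (Jlin _ _ _); rewrite -linearP -(tr v a x y).
have TE : bop_comp J T = ptens_lift bphi.
  by apply: ptens_ext => v w; exact/esym/(ptens_liftE bphi).
apply: opnorm_le => // x; rewrite -nJ.
have -> : J (T x) = ptens_lift bphi x by exact: (congr1 (fun g : bop _ _ => g x) TE).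
apply: le_trans (le_opnorm _ _) _; rewrite ler_wpM2r ?nrm_ge0//.
exact: (nrm_ptens_lift bphi c0 hphi).
Qed.

(** By [nrm_ptens_le], the norm of [phi] is determined by its values on products of unit vectors.
    The real part can stand for the modulus because a phase is absorbed into the left vector. *)
Lemma ptens_norming (V W : normedModType R[i]) (phi : dual_space (ptens V W)) (d : R) :
  0 < d -> exists x : V * W,
    [/\ nrm x.1 <= 1, nrm x.2 <= 1 & nrm phi - d <= complex.Re (phi (tens x.1 x.2))].
Proof.
move=> d0; have [tl tr] := tens_bilinear V W; apply: contrapT => hn.
have lt_phi x y : nrm x <= 1 -> nrm y <= 1 ->
    complex.Re (phi (tens x y)) < nrm phi - d.
  by move=> x1 y1; rewrite ltNge; apply/negP => h; apply: hn; exists (x, y).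
have z1 (U : normedModType R[i]) : nrm (0 : U) <= 1 by rewrite nrm0.
have t0 w : tens 0 w = 0 :> ptens V W.
  by have := bilinear_mapZl 0 0 w (tens_bilinear V W); rewrite !scale0r.
have t0r v : tens v 0 = 0 :> ptens V W.
  by have := tr v (-1) 0 0; rewrite !scaleN1r oppr0 addr0 addNr.
(* The pair [(0, 0)] shows that the candidate bound is positive, while [nrm_ptens_le] asks for a
   nonnegative constant. *)
have c0 : 0 < nrm phi - d.
  by have := lt_phi 0 0 (z1 _) (z1 _); rewrite t0 raddf0.
suff : nrm phi <= nrm phi - d by rewrite lerBrDr gerDl leNgt d0.
apply: nrm_ptens_le => [|v w]; first exact: ltW.
have [->|v0] := eqVneq v 0; first by rewrite t0 raddf0 !nrm0 mul0r mulr0.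
have [->|w0] := eqVneq w 0; first by rewrite t0r raddf0 !nrm0 !mulr0.
set z := phi (tens v w); have [->|z0] := eqVneq z 0.
  by rewrite nrm0 mulr_ge0 ?mulr_ge0 ?nrm_ge0// ltW.
have [nv nw] := (nrm_gt0 v0, nrm_gt0 w0); have nz := nrm_gt0 z0.
(* Both scalars normalise their vector; [k] also carries the phase that turns the value of [phi]
   into the positive real [nrm z / nrm v / nrm w]. *)
pose k : R[i] := (nrm z / nrm v)%:C / z; pose l : R[i] := (nrm w)^-1%:C.
have kv : nrm (k *: v) <= 1.
  have nk : nrm k = (nrm v)^-1.
    rewrite /k nrmM nrmV// nrm_real ger0_norm ?divr_ge0 ?ltW//.
    by rewrite mulrAC mulfV ?gt_eqF// mul1r.
  by rewrite nrmZ nk mulVf ?gt_eqF.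
have lw : nrm (l *: w) <= 1.
  by rewrite nrmZ nrm_real ger0_norm ?invr_ge0 ?nrm_ge0// mulVf ?gt_eqF.
have := lt_phi _ _ kv lw.
have -> : phi (tens (k *: v) (l *: w)) = (nrm z / nrm v / nrm w)%:C :> R[i].
  rewrite (bilinear_mapZl k v _ (tens_bilinear V W)).
  have -> : tens v (l *: w) = l *: tens v w :> ptens V W.
    by have := tr v l w 0; rewrite t0r !addr0.
  have dualZ c u : phi (c *: u) = c * phi u :> R[i].
    by have := dual_linear phi c u 0; rewrite raddf0 !addr0.
  rewrite !dualZ -/z /k /l mulrCA divfK//.
  by rewrite -rmorphM/= mulrC.
by rewrite ltr_pdivrMr// ltr_pdivrMr// -mulrA (mulrC (nrm w)) => /ltW.
Qed.

Lemma ptens_map_norming (V V' W W' : normedModType R[i]) (S : bop V V') (T : bop W W')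
    (phi : dual_space (ptens V' W')) (d : R) : 0 < d -> exists x : V * W,
  [/\ nrm x.1 <= 1, nrm x.2 <= 1 & nrm (adjoint (ptens_map S T) phi) - d <=
    complex.Re (phi (tens (S x.1) (T x.2)))].
Proof.
move=> d0; have [x [x1 x2 h]] := ptens_norming (adjoint (ptens_map S T) phi) d0.
by exists x; split=> //; move: h; rewrite adjointE ptens_mapE.
Qed.

End BilinearForms.

(** * Coordinate embeddings and projections of the E-sum *)

Section Coordinates.
Context {R : realType} {I : choiceType} (E : bseqLattice R I)
  (A : I -> banachAlgType R[i]).
Local Notation S := (Esum E A).

Lemma finite_support_mem (a : forall i, A i) : finite_set [set i | a i != 0] ->
  bsl_mem E (nseq_of a).
Proof.
move=> af; apply: bsl_c00; apply: sub_finite_set af => i /=.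
by rewrite /nseq_of normr_eq0.
Qed.

Lemma Esum_single_mem i (x : A i) :
  bsl_mem E (nseq_of (dfwith (fun j => 0 : A j) i x)).
Proof.
apply: finite_support_mem; apply: sub_finite_set (finite_set1 i) => j /=.
by case: dfwithP => // k _; rewrite eqxx.
Qed.

Definition Esum_single i (x : A i) : S := mkEsum (Esum_single_mem x).

Lemma Esum_single_in i (x : A i) : Esum_single x i = x.
Proof. exact: dfwithin. Qed.

Lemma Esum_single_out i (x : A i) j : i != j -> Esum_single x j = 0.
Proof. exact: dfwithout. Qed.

Lemma Esum_single_linear i : linear (@Esum_single i).
Proof.
move=> c x y; apply: Esum_eq => j; rewrite EsumDE EsumZE.
have [<-|ij] := eqVneq i j; first by rewrite !Esum_single_in.
by rewrite !Esum_single_out// scaler0 addr0.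
Qed.

Lemma nrm_Esum_le (a : S) (e : E) (c : R) : 0 <= c ->
  (forall i, nrm (a i) <= c * nrm (bsl_fun e i : R[i])) -> nrm a <= c * nrm e.
Proof.
move=> c0 h; have -> : c * nrm e = nrm (c%:C *: e) by rewrite nrmZ nrm_real ger0_norm.
rewrite nrm_Esum; apply: (@Esum_solid _ _ _ _ _ (c%:C *: e) _).2 => i.
by apply: le_trans (h i) _; rewrite bsl_funZ nrmM nrm_real ger0_norm.
Qed.

Lemma char_mem (F : set I) : finite_set F -> exists e : E, bsl_fun e = \1_F :> (I -> R[i]).
Proof.
move=> fF; apply: bsl_c00; apply: sub_finite_set fF => i /=.
by rewrite indicE; case: (boolP (i \in F)) => [/set_mem//|_]; rewrite eqxx.
Qed.

(** Comparison with indicators is how the norms of characteristic functions, and through them [C_E],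
    enter the estimates. *)
Lemma nrm_Esum_char (a : S) (F : set I) (c : R) : finite_set F -> 0 <= c ->
  (forall i, nrm (a i) <= c * (i \in F)%:R) -> nrm a <= c * bsl_norm E (\1_F : I -> R[i]).
Proof.
move=> /char_mem[e he] c0 h; rewrite -he bsl_normE; apply: nrm_Esum_le => // i.
apply: le_trans (h i) _; rewrite he indicE.
by case: (i \in F); rewrite ?nrm1 ?nrm0.
Qed.

(** The embedding need not be contractive: its bound is the lattice norm of the indicator of [i]. *)
Lemma Esum_single_bounded i : bounded_op (@Esum_single i).
Proof.
split; first exact: Esum_single_linear.
exists (bsl_norm E (\1_[set i] : I -> R[i])) => x.
rewrite mulrC; apply: nrm_Esum_char => [||j]; [exact: finite_set1|exact: nrm_ge0|].
have [<-|ij] := eqVneq i j; first by rewrite Esum_single_in mem_set// mulr1.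
by rewrite Esum_single_out// nrm0 mulr_ge0 ?nrm_ge0.
Qed.

Definition Esum_inj i : bop (A i) S := mkBop (@Esum_single_bounded i).

Lemma Esum_inj_in i (x : A i) : Esum_inj i x i = x.
Proof. exact: Esum_single_in. Qed.

Lemma Esum_inj_out i (x : A i) j : i != j -> Esum_inj i x j = 0.
Proof. exact: Esum_single_out. Qed.

Lemma Esum_coord_bounded i : bounded_op (fun a : S => a i).
Proof.
split; first by move=> c a b; rewrite EsumDE EsumZE.
by exists 1 => a; rewrite mul1r; exact: le_Esum_norm.
Qed.

Definition Esum_coord i : bop S (A i) := mkBop (@Esum_coord_bounded i).

Lemma nrm_Esum_coord i : nrm (Esum_coord i) <= 1.
Proof. by apply: opnorm_le => // a; rewrite mul1r; exact: le_Esum_norm. Qed.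

Lemma AM_coord_le i : (AM (A i) <= AM S)%E.
Proof.
apply: (@AM_image _ _ _ (Esum_coord i)) => //; last exact: nrm_Esum_coord.
by move=> x; exists (Esum_inj i x); exact: Esum_single_in.
Qed.

Lemma Esum_sumE (F : {fset I}) (a : S) j :
  (\sum_(i <- F) Esum_inj i (a i)) j = if j \in F then a j else 0.
Proof.
rewrite -[LHS]/(Esum_coord j _) raddf_sum (eq_bigr (fun i => Esum_single (a i) j))//.
case: ifPn => jF.
  rewrite (big_fsetD1 j)// Esum_single_in big1_fset => [|i]; first exact: addr0.
  by rewrite !inE => /andP[ij _] _; exact: Esum_single_out.
rewrite big1_fset// => i iF _; apply: Esum_single_out.
by apply: contraNneq jF => <-.
Qed.

(** Density of the finitely supported functions is used here. If [g] approximates the modulus of [a]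
    and [F] contains the support of [g], then off [F] the modulus equals its difference with [g], so
    solidity makes the tail small. *)
Lemma has_fsum_coord (a : S) : has_fsum (fun i => Esum_inj i (a i)) a.
Proof.
move=> e e0; have [f fa _] := Esum_rep a.
have [g [gf gs]] : exists g : E, nrm (f - g) < e /\
    finite_set [set i | bsl_fun g i != 0].
  have [||g [/nrm_ball fg gs]] := @bsl_dense _ _ E (ball f e%:C); last by exists g.
  - by exists f; apply: ballxx; rewrite ltcR.
  - exact: ball_open.
exists (fset_set [set i | bsl_fun g i != 0]) => F FF.
apply: le_lt_trans gf; rewrite -[leRHS]mul1r; apply: nrm_Esum_le => // j.
rewrite mul1r EsumBE Esum_sumE; case: ifPn => jF; first by rewrite subrr nrm0 nrm_ge0.
rewrite sub0r nrmN bsl_funB fa.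
have -> : bsl_fun g j = 0.
  apply/eqP; apply: contraNT jF => gj; apply: (fsubsetP FF).
  by rewrite in_fset_set// mem_set.
by rewrite subr0 nseq_ofE.
Qed.

(** With [bmul_injl]: each coordinate is a two-sided ideal, on which [a] acts through [a i]
    alone. *)
Lemma bmul_injr i (a : S) (x : A i) :
  bmul a (Esum_inj i x) = Esum_inj i (bmul (a i) x).
Proof.
apply: Esum_eq => j; rewrite -[LHS]/(bmul (a j) (Esum_single x j)).
have [<-|ij] := eqVneq i j; first by rewrite !Esum_single_in.
by rewrite !Esum_single_out//; exact: (raddf0 (lmul (a j))).
Qed.

Lemma bmul_injl i (a : S) (x : A i) :
  bmul (Esum_inj i x) a = Esum_inj i (bmul x (a i)).
Proof.
apply: Esum_eq => j; rewrite -[LHS]/(bmul (Esum_single x j) (a j)).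
have [<-|ij] := eqVneq i j; first by rewrite !Esum_single_in.
by rewrite !Esum_single_out//; exact: (raddf0 (rmul (a j))).
Qed.

End Coordinates.

(** * The virtual diagonal of the E-sum *)

Section Diagonals.
Context {R : realType} {I : choiceType} (E : bseqLattice R I)
  (A : I -> banachAlgType R[i]).
Local Notation S := (Esum E A).
Local Notation inj := (Esum_inj E A).
Local Notation diag i := (ptens_map (inj i) (inj i)).

(* The signs are chosen one at a time: for [u +- a] and [v +- b] the cross terms
   [phi (a, v) + phi (u, b)] can be made to contribute a nonnegative real part. *)
Lemma signed_sums (phi : dual_space (ptens S S)) (x : forall i, A i * A i) (s : seq I) :
  (forall i, nrm (x i).1 <= 1 /\ nrm (x i).2 <= 1) -> uniq s ->
  exists u v : S, [/\ forall j, nrm (u j) <= (j \in s)%:R,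
    forall j, nrm (v j) <= (j \in s)%:R &
    \sum_(i <- s) complex.Re (phi (tens (inj i (x i).1) (inj i (x i).2))) <=
      complex.Re (phi (tens u v))].
Proof.
move=> x1; have [tl tr] := tens_bilinear S S.
have phiDl c y z t : phi (tens (c *: y + z) t) = c * phi (tens y t) + phi (tens z t) :> R[i].
  exact: etrans (congr1 phi (tl t c y z)) (dual_linear phi _ _ _).
have phiDr c y z t : phi (tens y (c *: z + t)) = c * phi (tens y z) + phi (tens y t) :> R[i].
  exact: etrans (congr1 phi (tr y c z t)) (dual_linear phi _ _ _).
have ReM (c : R) (z : R[i]) : complex.Re (c%:C * z) = c * complex.Re z.
  by case: z => p q; rewrite /= mul0r subr0.
elim: s => [_|i s ih /andP[ins /ih{ih}[u [v [us vs uv]]]]].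
  exists 0, 0; split=> [j|j|]; rewrite ?nrm0// big_nil.
  have := phiDl (-1) 0 0 0; rewrite scaler0 addr0 mulN1r addNr => ->.
  by [].
set a := inj i (x i).1; set b := inj i (x i).2.
pose w := complex.Re (phi (tens a v) + phi (tens u b)).
pose e : R := if 0 <= w then 1 else -1.
have ew : 0 <= e * w.
  by rewrite /e; case: (leP 0 w) => w0; rewrite ?mul1r// mulN1r oppr_ge0 ltW.
(* The diagonal term carries the sign twice and is unchanged; the cross terms carry it once and
   contribute [e * w]. *)
have ee : e * e = 1 by rewrite /e; case: ifP; rewrite ?mulrNN mulr1.
have ne : nrm e%:C = 1 by rewrite nrm_real /e; case: ifP; rewrite ?normrN normr1.
(* As [i] is not in [s], the new vector sits in a coordinate where [c] vanishes, so the
   coordinatewise bound by 1 survives. *)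
have coord (c : S) (y : A i) : nrm y <= 1 -> (forall j, nrm (c j) <= (j \in s)%:R) ->
    forall j, nrm ((e%:C *: inj i y + c) j) <= (j \in i :: s)%:R.
  move=> y1 cs j; rewrite EsumDE EsumZE inE.
  apply: le_trans (ler_nrmD _ _) _; rewrite nrmZ ne mul1r.
  have [->|ji] := eqVneq j i; last first.
    by rewrite Esum_inj_out 1?eq_sym// nrm0 add0r.
  have /eqP -> : nrm (c i) == 0.
    by rewrite eq_le nrm_ge0 andbT; have := cs i; rewrite (negbTE ins).
  by rewrite addr0 Esum_inj_in.
exists (e%:C *: a + u), (e%:C *: b + v); split.
- by apply: coord => //; case: (x1 i).
- by apply: coord => //; case: (x1 i).
rewrite big_cons.
have -> : phi (tens (e%:C *: a + u) (e%:C *: b + v)) =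
    phi (tens a b) + e%:C * (phi (tens a v) + phi (tens u b)) + phi (tens u v) :> R[i].
  rewrite phiDl !phiDr mulrDr mulrA -rmorphM ee mul1r mulrDr !addrA.
  by congr (_ + _); rewrite -!addrA.
rewrite !raddfD/= ReM -addrA lerD2l; apply: le_trans uv _.
by rewrite lerDr.
Qed.

(** [signed_sums] collects almost norming pairs for all [i] in [F] into one value of [phi], at two
    vectors dominated by the indicator of [F] and hence of norm at most [C]. *)
Lemma sum_nrm_diag (C : R) (phi : dual_space (ptens S S)) (F : {fset I}) :
  (forall G : set I, finite_set G -> bsl_norm E (\1_G : I -> R[i]) <= C) ->
  \sum_(i <- F) nrm (adjoint (diag i) phi) <= C ^+ 2 * nrm phi.
Proof.
move=> hC; apply/ler_addgt0Pr => e e0.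
(* The total error is [size F] times [d], at most [e]; the successor keeps the divisor nonzero for
   empty [F]. *)
pose d := e / (size F).+1%:R; have d0 : 0 < d by rewrite divr_gt0 ?ltr0n.
pose x i := sval (cid (ptens_map_norming (inj i) (inj i) phi d0)).
have hx i := svalP (cid (ptens_map_norming (inj i) (inj i) phi d0)).
rewrite -/(x _) in hx.
have [//|u [v [us vs uv]]] := @signed_sums phi x F _ (fset_uniq F).
  by move=> i; have [] := hx i.
have bnd (w : S) : (forall j, nrm (w j) <= (j \in F)%:R) -> nrm w <= C.
  move=> ws; apply: le_trans (hC [set` F] (finite_fset F)).
  rewrite -[leRHS]mul1r; apply: nrm_Esum_char => // j; rewrite mul1r.
  by have -> : (j \in [set` F]) = (j \in F) by apply/idP/idP => [/set_mem|/mem_set].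
have Re_phi : complex.Re (phi (tens u v)) <= C ^+ 2 * nrm phi.
  have := normc_ge_Re (phi (tens u v)); rewrite nrmE lecR => /(le_trans (ler_norm _)).
  move=> /le_trans; apply; apply: le_trans (le_opnorm phi _) _.
  rewrite mulrC; apply: ler_wpM2r; first exact: opnorm_ge0.
  apply: le_trans (nrm_tens_le _ _) _.
  by rewrite expr2 ler_pM ?nrm_ge0// bnd.
have : \sum_(i <- F) (nrm (adjoint (diag i) phi) - d) <= C ^+ 2 * nrm phi.
  by apply: le_trans (le_trans uv Re_phi); apply: ler_sum => i _; case: (hx i).
rewrite sumrB lerBlDr => /le_trans; apply; rewrite lerD2l.
rewrite big_const_seq count_predT iter_addr_0 -[X in X <= _]mulr_natr /d mulrAC ler_pdivrMr ?ltr0n//.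
by rewrite ler_wpM2l ?ler_nat// ltW.
Qed.

Section Sum.
Context (C T : R) (M : forall i, dual_space (dual_space (ptens (A i) (A i)))).
Hypothesis C_char : forall G : set I, finite_set G -> bsl_norm E (\1_G : I -> R[i]) <= C.
Hypothesis T0 : 0 <= T.
Hypothesis M_le : forall i, nrm (M i) <= T.
Hypothesis M_diag : forall i, virtual_diagonal (M i).

Let term (phi : dual_space (ptens S S)) i : R[i]^o := M i (adjoint (diag i) phi).

Let term_le phi (F : {fset I}) : \sum_(i <- F) nrm (term phi i) <= T * C ^+ 2 * nrm phi.
Proof.
rewrite -mulrA; apply: le_trans (ler_wpM2l T0 (sum_nrm_diag phi F C_char)).
rewrite mulr_sumr; apply: ler_sum => i _; apply: le_trans (le_opnorm (M i) _) _.
by apply: ler_wpM2r; [exact: nrm_ge0|exact: M_le].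
Qed.

(** A choice of limit; [has_fsum_uniq] makes it the only one, whence linearity. *)
Definition sum_diag phi : R[i]^o := sval (cid (abs_summable (term_le phi))).

Lemma sum_diagP phi : has_fsum (term phi) (sum_diag phi).
Proof. exact: svalP (cid (abs_summable (term_le phi))). Qed.

Lemma sum_diag_linear : linear sum_diag.
Proof.
move=> c f g; apply: has_fsum_uniq (sum_diagP _) _.
have := has_fsum_lin c (sum_diagP f) (sum_diagP g).
by congr has_fsum; apply/funext => i; rewrite /term !linearP.
Qed.

Lemma sum_diag_le phi : nrm (sum_diag phi) <= T * C ^+ 2 * nrm phi.
Proof.
apply: has_fsum_le (sum_diagP phi) _ => F; apply: le_trans (term_le phi F).
elim/big_rec2: _ => [|i y z _ h]; first by rewrite nrm0.
by apply: le_trans (ler_nrmD _ _) _; rewrite lerD2l.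
Qed.

Lemma sum_diag_bounded : bounded_op sum_diag.
Proof.
by split; [exact: sum_diag_linear|exists (T * C ^+ 2) => phi; exact: sum_diag_le].
Qed.

Definition sum_diagonal : dual_space (dual_space (ptens S S)) := mkBop sum_diag_bounded.

Lemma nrm_sum_diagonal : nrm sum_diagonal <= T * C ^+ 2.
Proof.
apply: opnorm_le => [|phi]; last exact: sum_diag_le.
by rewrite mulr_ge0// sqr_ge0.
Qed.

(** Treats left and right multiplication at once: [h] is multiplication by [a] and [k i] by [a i].
    Each term collapses to [f (inj i (a i))], and these sum to [f a] by [has_fsum_coord]. *)
Lemma sum_diagonal_mul (a : S) (f : dual_space S) (h : bop S S) (k : forall i, bop (A i) (A i)) :
  (forall i, bop_comp h (inj i) = bop_comp (inj i) (k i)) ->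
  (forall i, biadjoint (k i) (biadjoint (prod_map (A i)) (M i)) = bidual_eval (a i)) ->
  biadjoint h (biadjoint (prod_map S) sum_diagonal) f = f a.
Proof.
move=> hk kM; apply: has_fsum_uniq (sum_diagP (adjoint (prod_map S) (adjoint h f))) _.
have := has_fsum_bop f (has_fsum_coord a); congr has_fsum; apply/funext => i.
have e := congr1 (fun N : dual_space (dual_space (A i)) => N (adjoint (inj i) f)) (kM i).
apply: (etrans (esym e)); rewrite /term.
transitivity (M i (adjoint (prod_map (A i)) (adjoint (inj i) (adjoint h f)))).
  by congr (bop_fun (M i) _); congr (bop_fun (adjoint _) _); exact/esym/adjoint_square.
congr (bop_fun (M i) _); apply/esym/adjoint_square/prod_ptens_map.
by move=> x y; rewrite bmul_injr Esum_inj_in.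
Qed.

(** The identities hold term by term, since restriction to coordinate [i] turns the action of [a]
    into that of [a i]; uniqueness of sums then compares the totals. *)
Lemma virtual_diagonal_sum : virtual_diagonal sum_diagonal.
Proof.
move=> a; split; apply: bopP => f.
- apply: has_fsum_uniq (sum_diagP (adjoint (lact a) f)) _.
  have := sum_diagP (adjoint (ract a) f); congr has_fsum; apply/funext => i.
  have [Mi _ _] := M_diag (a i).
  have e := congr1 (fun N : dual_space (dual_space _) => N (adjoint (diag i) f)) Mi.
  rewrite /term; transitivity (M i (adjoint (ract (a i)) (adjoint (diag i) f))).
    congr (bop_fun (M i) _); apply/adjoint_square/ract_ptens_map => x.
    exact: bmul_injl.
  apply: (etrans (esym e)); congr (bop_fun (M i) _).
  by apply/esym/adjoint_square/lact_ptens_map => x; exact: bmul_injr.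
- apply: (@sum_diagonal_mul a f (lmul a) (fun i => lmul (a i))) => i; last by case: (M_diag (a i)).
  by apply: bopP => x; exact: bmul_injr.
- apply: (@sum_diagonal_mul a f (rmul a) (fun i => rmul (a i))) => i; last by case: (M_diag (a i)).
  by apply: bopP => x; exact: bmul_injl.
Qed.

End Sum.
End Diagonals.

(** * The bounds for the amenability constant *)

Local Open Scope ereal_scope.

Theorem theorem4p1 (R : realType) (I : Type) (I_nonempty : inhabited I)
    (E : bseqLattice R I) (A : I -> banachAlgType R[i]) :
  ereal_sup [set AM (A i) | i in [set: I]] <= AM (Esum E A) /\
  (char_const E < +oo ->
    (amenable (Esum E A) <-> ereal_sup [set AM (A i) | i in [set: I]] < +oo) /\
    (amenable (Esum E A) ->
      ereal_sup [set AM (A i) | i in [set: I]] <= AM (Esum E A) /\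
      AM (Esum E A) <=
        char_const E ^+ 2 * ereal_sup [set AM (A i) | i in [set: I]])).
Proof.
have lower : ereal_sup [set AM (A i) | i in [set: I]] <= AM (Esum E A).
  (* [{classic I}] gives [I] the choice structure assumed in the sections above. *)
  by apply: ge_ereal_sup => _ [i _ <-]; exact: (@AM_coord_le R {classic I} E A i).
split=> // E_fin.
have [C charE C_char] : exists2 C : R, char_const E = C%:E &
    forall F : set I, finite_set F -> (bsl_norm E (\1_F : I -> R[i]) <= C)%R.
  (* The empty set contributes a nonnegative number, which excludes [-oo]; together with [E_fin] the
     supremum is a real [C]. *)
  have char0 : 0 <= char_const E.
    apply: (@le_trans _ _ (bsl_norm E (\1_set0 : I -> R[i]))%:E).
      by rewrite lee_fin nrm_ge0.
    by apply: ereal_sup_ubound; exists set0 => //; exact: finite_set0.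
  have charE : char_const E = (fine (char_const E))%:E.
    by rewrite fineK// ge0_fin_numE.
  exists (fine (char_const E)) => // F fF; rewrite -lee_fin -charE.
  by apply: ereal_sup_ubound; exists F.
set s := ereal_sup _ in lower *.
have s0 : 0 <= s.
  (* Non-emptiness matters: over an empty family the supremum would be [-oo]. *)
  case: (I_nonempty) => i; apply: (@le_trans _ _ (AM (A i))); last first.
    by apply: ereal_sup_ubound; exists i.
  by apply: le_ereal_inf_tmp => _ [M _ <-]; rewrite lee_fin nrm_ge0.
(* The infimum [AM (A i)] need not be attained, so [T] lies strictly above [s]; then every [A i] has
   a virtual diagonal of norm at most [T]. *)
have upper (T : R) : s < T%:E ->
    exists2 M, @virtual_diagonal R (Esum E A) M & (nrm M <= T * C ^+ 2)%R.
  move=> sT; have T0 : (0 <= T)%R by rewrite -lee_fin (le_trans s0 (ltW sT)).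
  have hM i : exists M : dual_space (dual_space (ptens (A i) (A i))),
      virtual_diagonal M /\ (nrm M <= T)%R.
    have : AM (A i) < T%:E by apply: le_lt_trans sT; apply: ereal_sup_ubound; exists i.
    by move=> /ereal_inf_lt[_ [M Md <-]]; rewrite lte_fin => /ltW; exists M.
  pose M i := sval (cid (hM i)).
  have M_diag i : virtual_diagonal (M i) by case: (svalP (cid (hM i))).
  have M_le i : (nrm (M i) <= T)%R by case: (svalP (cid (hM i))).
  exists (@sum_diagonal R {classic I} E A C T M C_char T0 M_le).
    exact: (@virtual_diagonal_sum R {classic I} E A C T M C_char T0 M_le M_diag).
  exact: (@nrm_sum_diagonal R {classic I}).
have AM_fin : amenable (Esum E A) -> s < +oo.
  move=> [M Md]; apply: le_lt_trans lower (le_lt_trans _ (ltry (nrm M))).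
  by apply: ereal_inf_lbound; exists M.
split; first split=> // s_fin.
  have [|M Md _] := upper (fine s + 1)%R; last by exists M.
  by rewrite EFinD fineK ?ge0_fin_numE// lteDl ?lte_fin ?ge0_fin_numE.
move=> /AM_fin s_fin; split=> //.
have sE : s = (fine s)%:E by rewrite fineK// ge0_fin_numE.
rewrite sE charE -EFin_expe -EFinM; apply/lee_addgt0Pr => e e0.
(* The excess of [T] over [s] is chosen to cost at most [e] after multiplication by [C ^+ 2]; adding
   1 keeps the divisor positive. *)
have c1 : (0 < C ^+ 2 + 1)%R by rewrite ltr_wpDl// sqr_ge0.
pose T := (fine s + e / (C ^+ 2 + 1))%R.
have [|M Md Mle] := upper T.
  by rewrite sE lte_fin ltrDl divr_gt0.
apply: (@le_trans _ _ (nrm M)%:E); first by apply: ereal_inf_lbound; exists M.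
rewrite -EFinD lee_fin; apply: le_trans Mle _.
rewrite /T mulrDl mulrC lerD2l mulrAC ler_pdivrMr// ler_wpM2l//; first exact: ltW.
by rewrite lerDl.
Qed.
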